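(* Let $K$ be a field and let $\mathcal{C}$ be a polyocollection. Then $\sqrt{I_{\mathcal{C}}}=\bigcap_X J_X$, where $X$ ranges over all admissible sets of $\mathcal{C}$.
   Context: Intervals: for $a=(i,j)\le b=(k,l)$ in $\mathbb{Z}^2$ (componentwise order), $[a,b]=\{(m,n)\in\mathbb{Z}^2: i\le m\le k,\ j\le n\le l\}$; it is proper if $i<k$ and $j<l$. A proper interval $I=[a,b]$ has diagonal corners $a,b$ and anti-diagonal corners $c=(i,l)$, $d=(k,j)$; $V(I)=\{a,b,c,d\}$ and $E(I)=\{[a,c],[a,d],[d,b],[c,b]\}$ is its set of edges; the boundary of an edge is the set of its two endpoints. $\mathrm{c}(I)=\{(m,n)\in\mathbb{R}^2: i\le m\le k,\ j\le n\le l\}$ and $\mathrm{int}(I)=\{(r,s)\in\mathbb{R}^2: i<r<k,\ j<s<l\}$. A polyocollection is a finite collection $\mathcal{C}$ of proper intervals such that for all $I\neq J$ in $\mathcal{C}$ we have $I\nsubseteq J$ and one of the following holds: (1) $I\cap J$ is a common edge of $I$ and $J$; (2) $|F\cap G|\le 1$ for all $F\in E(I)$ and $G\in E(J)$. The empty set is considered a polyocollection. $V(\mathcal{C})=\bigcup_{I\in\mathcal{C}}V(I)$. An inner interval of $\mathcal{C}$ is an interval $I$ for which there are $I_1,\dots,I_n\in\mathcal{C}$ with $\mathrm{c}(I)=\bigcup_{i=1}^n\mathrm{c}(I_i)$ and $\mathrm{int}(I_k)\cap\mathrm{int}(I_l)=\emptyset$ for $k\ne l$; $G(\mathcal{C})$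 is the set of inner intervals of $\mathcal{C}$ ($G(\emptyset)=\emptyset$). $S_{\mathcal{C}}=K[x_a:a\in V(\mathcal{C})]$, and $I_{\mathcal{C}}$ is the ideal generated by $f_I=x_ax_b-x_cx_d$ for all $I=[a,b]\in G(\mathcal{C})$ with diagonal corners $a,b$ and anti-diagonal corners $c,d$. Lattice ideal: for $I=[a,b]$ with anti-diagonal corners $c,d$ put $\mathbf{v}_I=\mathbf{v}_a+\mathbf{v}_b-\mathbf{v}_c-\mathbf{v}_d$, where $\mathbf{v}_r$ is the standard basis vector indexed by the vertex $r$. For a polyocollection $\mathcal{D}$, $\Lambda_{\mathcal{D}}\subseteq\mathbb{Z}^{|V(\mathcal{D})|}$ is the subgroup generated by $\{\mathbf{v}_I: I\in\mathcal{D}\}$ and $L_{\mathcal{D}}=(x^{\mathbf{e}^+}-x^{\mathbf{e}^-}:\mathbf{e}\in\Lambda_{\mathcal{D}})$, where $\mathbf{e}^+$ is obtained from $\mathbf{e}$ by replacing negative entries by $0$ and $\mathbf{e}^-=\mathbf{e}^+-\mathbf{e}$. An admissible set of $\mathcal{C}$ is a subset $X\subseteq V(\mathcal{C})$ such that for every $I\in G(\mathcal{C})$ either $X\cap V(I)=\emptyset$ or $X\cap V(I)$ contains the boundary of an edge of $I$. For an admissible set $X$ put $\mathcal{G}^{(X)}=\{I\in G(\mathcal{C}): V(I)\cap X=\emptyset\}$; $\mathcal{C}^{(X)}$ denotes the polyocollection having $\mathcal{G}^{(X)}$ as its set of inner intervals, namely the set of inclusion-minimal elements of $\mathcal{G}^{(X)}$.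 Define $J_X=(x_a:a\in X)+L_{\mathcal{C}^{(X)}}\subseteq S_{\mathcal{C}}$ (with $L_{\mathcal{C}^{(X)}}$ extended to $S_{\mathcal{C}}$).
   Formalization: C^(X) is taken as the unique irredundant collection of proper intervals whose inner intervals are G^(X); it is the paper's C^(X) whenever that polyocollection exists. For some admissible X none exists, and with the inclusion-minimal elements of G^(X) the equality can fail. *)

(* Defs.v *)
From mathcomp Require Export all_boot all_order all_algebra finmap.
From mathcomp Require Export boolp classical_sets reals.
From mathcomp Require Export mpoly.

Set Implicit Arguments.
Unset Strict Implicit.
Unset Printing Implicit Defensive.

Import Order.TTheory GRing.Theory Num.Theory.

Local Open Scope ring_scope.

Notation point := (int * int)%type.

(* The pair [(a, b)] stands for the interval [a, b] of Z^2.  A pair is an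
   interval only when [interval] below holds. *)
Notation zitv := (point * point)%type.

Definition lep (p q : point) : bool := (p.1 <= q.1) && (p.2 <= q.2).

Definition interval (I : zitv) : bool := lep I.1 I.2.

Definition proper (I : zitv) : bool := (I.1.1 < I.2.1) && (I.1.2 < I.2.2).

Definition pts (I : zitv) : set point := [set p | lep I.1 p && lep p I.2]%classic.

(* Diagonal corners a, b and anti-diagonal corners c, d *)
Definition cornera (I : zitv) : point := I.1.
Definition cornerb (I : zitv) : point := I.2.
Definition cornerc (I : zitv) : point := (I.1.1, I.2.2).
Definition cornerd (I : zitv) : point := (I.2.1, I.1.2).

Definition verts (I : zitv) : {fset point} :=
  [fset cornera I; cornerb I; cornerc I; cornerd I]%fset.

Definition edges (I : zitv) : seq zitv :=
  [:: (cornera I, cornerc I); (cornera I, cornerd I);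
      (cornerd I, cornerb I); (cornerc I, cornerb I)].

Definition boundary (F : zitv) : {fset point} := [fset F.1; F.2]%fset.

Definition polyocollection (C : {fset zitv}) : Prop :=
  (forall I, I \in C -> proper I) /\
  (forall I J, I \in C -> J \in C -> I != J ->
     ~ (pts I `<=` pts J)%classic /\
     ((exists F, [/\ F \in edges I, F \in edges J
                   & (pts I `&` pts J)%classic = pts F]) \/
      (forall F G, F \in edges I -> G \in edges J ->
         is_subset1 (pts F `&` pts G)%classic))).

Definition vset (C : {fset zitv}) : {fset point} :=
  (\bigcup_(I <- C) verts I)%fset.

Definition real_cl (R : realType) (I : zitv) : set (R * R) :=
  [set p | [/\ I.1.1%:~R <= p.1, p.1 <= I.2.1%:~R,
               I.1.2%:~R <= p.2 & p.2 <= I.2.2%:~R]]%classic.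

Definition real_int (R : realType) (I : zitv) : set (R * R) :=
  [set p | [/\ I.1.1%:~R < p.1, p.1 < I.2.1%:~R,
               I.1.2%:~R < p.2 & p.2 < I.2.2%:~R]]%classic.

Arguments real_cl R I : clear implicits.
Arguments real_int R I : clear implicits.

(* The set G(C) of inner intervals *)
Definition inner (R : realType) (C : {fset zitv}) : set zitv :=
  [set I | interval I /\
     exists (n : nat) (T : 'I_n -> zitv),
       [/\ forall i, T i \in C,
           real_cl R I = (\bigcup_i real_cl R (T i))%classic
         & forall k l, k != l ->
             (real_int R (T k) `&` real_int R (T l))%classic = set0]]%classic.

Section Ideals.
Variable A : comNzRingType.

Definition ideal_span (G : set A) : set A :=
  [set f | exists (n : nat) (h g : 'I_n -> A),
     (forall i, G (g i)) /\ f = \sum_i h i * g i]%classic.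

Definition ideal_add (I J : set A) : set A :=
  [set f | exists g h, [/\ I g, J h & f = g + h]]%classic.

Definition radical (I : set A) : set A :=
  [set f | exists2 n : nat, (0 < n)%N & I (f ^+ n)]%classic.

End Ideals.

Definition ideal_ext (A B : comNzRingType) (phi : A -> B) (I : set A) : set B :=
  ideal_span (phi @` I)%classic.

(* K[x_a : a in W]; the variables are numbered by [enum_rank]. *)
Notation polyring K W := {mpoly K[#|{: fset_sub_type W}|]}.

Section Polynomials.
Variables (K : fieldType) (W : {fset point}).

(* The variable x_a; the value 0 for [a \notin W] is a dummy. *)
Definition var (a : point) : polyring K W :=
  if insub a is Some u then 'X_(enum_rank (u : W)) else 0.

(* Z^W and its standard basis *)
Definition zvec (r : point) : {ffun W -> int} :=
  [ffun s : W => (val s == r)%:Z].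

Definition zvec_itv (I : zitv) : {ffun W -> int} :=
  zvec (cornera I) + zvec (cornerb I) - zvec (cornerc I) - zvec (cornerd I).

(* e^+ and e^-, with values in int *)
Definition pos_part (e : {ffun W -> int}) : {ffun W -> int} :=
  [ffun s => Num.max (e s) 0].
Definition neg_part (e : {ffun W -> int}) : {ffun W -> int} := pos_part e - e.

(* x^u, for u with nonnegative entries *)
Definition monomial (u : {ffun W -> int}) : polyring K W :=
  \prod_(s : W) var (val s) ^+ `|u s|%N.

End Polynomials.

Arguments var K W a : clear implicits.
Arguments zvec W r : clear implicits.
Arguments zvec_itv W I : clear implicits.
Arguments monomial K {W} u.

Section PolyocollectionIdeal.
Variables (R : realType) (K : fieldType) (C : {fset zitv}).

Definition inner_minor (I : zitv) : polyring K (vset C) :=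
  var K (vset C) (cornera I) * var K (vset C) (cornerb I)
  - var K (vset C) (cornerc I) * var K (vset C) (cornerd I).

(* I_C, with f_I = [inner_minor I]; the corners of an inner interval of C lie in
   [vset C] (lemma [inner_verts] below). *)
Definition polyo_ideal : set (polyring K (vset C)) :=
  ideal_span (inner_minor @` inner R C)%classic.

End PolyocollectionIdeal.

Arguments inner_minor K C I : clear implicits.
Arguments polyo_ideal R K C : clear implicits.

Section LatticeIdeal.
Variables (K : fieldType) (D : {fset zitv}).

(* Lambda_D: the integer combinations of the v_I, I in D *)
Definition lattice : set {ffun vset D -> int} :=
  [set e | exists c : zitv -> int,
     e = \sum_(I <- D) zvec_itv (vset D) I *~ c I]%classic.

(* L_D *)
Definition lattice_ideal : set (polyring K (vset D)) :=
  ideal_span ((fun e => monomial K (pos_part e) - monomial K (neg_part e))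
                @` lattice)%classic.

End LatticeIdeal.

Arguments lattice D : clear implicits.
Arguments lattice_ideal K D : clear implicits.

(* The K-algebra morphism K[x_a : a in V] -> K[x_a : a in W], x_a |-> x_a,
   for V included in W *)
Definition var_incl (K : fieldType) (V W : {fset point}) (p : polyring K V) :
    polyring K W :=
  comp_mpoly [tuple var K W (val (enum_val i)) | i < #|{: V}|] p.

Section Admissible.
Variables (R : realType) (C : {fset zitv}).

Definition admissible (X : {fset point}) : Prop :=
  (X `<=` vset C)%fset /\
  forall I, inner R C I ->
    (X `&` verts I)%fset = fset0 \/
    exists2 F, F \in edges I & (boundary F `<=` X `&` verts I)%fset.

(* G^(X) *)
Definition inner_avoiding (X : {fset point}) : set zitv :=
  [set I | inner R C I /\ (verts I `&` X)%fset = fset0]%classic.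

(* D is an irredundant collection having G^(X) as its set of inner intervals.
   There is exactly one such D: the set of the elements of G^(X) that are not
   tiled by other elements of G^(X).  If some polyocollection has G^(X) as
   its set of inner intervals, then this D is that polyocollection, and is the
   set of inclusion-minimal elements of G^(X).
   Inclusion-minimality cannot be used as the definition: for
   C = {[(-1,0),(1,3)], [(1,0),(2,3)], [(2,0),(4,3)], [(0,1),(3,2)]} and
   X = {(1,0), (1,3), (2,0), (2,3)} one finds
   G^(X) = {[(-1,0),(4,3)], [(0,1),(3,2)]}, whose only minimal element is
   [(0,1),(3,2)], and no polyocollection has G^(X) as its inner intervals. *)
Definition generates_avoiding (X : {fset point}) (D : {fset zitv}) : Prop :=
  [/\ forall I, I \in D -> proper I,
      forall I, I \in D -> ~ inner R (D `\ I)%fset I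
    & inner R D = inner_avoiding X].

(* C^(X) *)
Definition residual (X : {fset point}) : {fset zitv} :=
  xget fset0 [set D | generates_avoiding X D]%classic.

End Admissible.

Section ResidualSpec.
Variable R : realType.
Implicit Types (I J : zitv) (C D E : {fset zitv}) (X : {fset point}).

Lemma innerP C I : inner R C I <-> interval I /\
  exists2 s : {fset zitv}, (s `<=` C)%fset &
    (forall p, real_cl R I p <-> exists2 J, J \in s & real_cl R J p) /\
    (forall J J', J \in s -> J' \in s -> J != J' ->
       (real_int R J `&` real_int R J')%classic = set0).
Proof.
split=> -[iI].
  move=> [n [T [TC cov dis]]]; split=> //.
  exists [fset T i | i in 'I_n]%fset.
    by apply/fsubsetP => _ /imfsetP [i _ ->].
  split=> [p|J J' /imfsetP [i _ ->] /imfsetP [j _ ->] ne].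
    rewrite cov; split=> [[i _ ip]|[_ /imfsetP [i _ ->] ip]]; last by exists i.
    by exists (T i) => //; apply/imfsetP; exists i.
  by apply: dis; apply: contraNneq ne => ->.
move=> [s sC [cov dis]]; split=> //.
exists (size s), (fun i => nth I s i); split.
- by move=> i; apply: (fsubsetP sC); apply: mem_nth.
- apply/seteqP; split=> p; rewrite cov => -[].
    move=> J Js Jp; have Hi : (index J s < size s)%N by rewrite index_mem.
    by exists (Ordinal Hi) => //=; rewrite nth_index.
  by move=> i _ ip; exists (nth I s i) => //; apply: mem_nth.
- move=> k l kl; apply: dis; [exact: mem_nth | exact: mem_nth |].
  by rewrite nth_uniq ?fset_uniq.
Qed.

Lemma cl_sub I J : interval J ->
  (real_cl R J `<=` real_cl R I)%classic <->
  [&& I.1.1 <= J.1.1, J.2.1 <= I.2.1, I.1.2 <= J.1.2 & J.2.2 <= I.2.2].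
Proof.
move=> /andP [h1 h2]; split=> [sub|/and4P [a b c d] p].
  have [] := sub (J.1.1%:~R, J.1.2%:~R).
    by split; rewrite /= ?ler_int.
  have [] := sub (J.2.1%:~R, J.2.2%:~R).
    by split; rewrite /= ?ler_int.
  by rewrite /= !ler_int => *; apply/and4P.
case=> *; split.
- by apply: le_trans; last eassumption; rewrite ler_int.
- by apply: le_trans; first eassumption; rewrite ler_int.
- by apply: le_trans; last eassumption; rewrite ler_int.
- by apply: le_trans; first eassumption; rewrite ler_int.
Qed.

Lemma int_sub I J : interval J -> (real_cl R J `<=` real_cl R I)%classic ->
  (real_int R J `<=` real_int R I)%classic.
Proof.
move=> iJ /(cl_sub _ iJ) /and4P [a b c d] p []; split.
- by apply: le_lt_trans; last eassumption; rewrite ler_int.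
- by apply: lt_le_trans; first eassumption; rewrite ler_int.
- by apply: le_lt_trans; last eassumption; rewrite ler_int.
- by apply: lt_le_trans; first eassumption; rewrite ler_int.
Qed.

Lemma cl_interval I p : real_cl R I p -> interval I.
Proof.
by move=> [a b c d]; apply/andP; split;
  rewrite -(ler_int R); [apply: le_trans a b | apply: le_trans c d].
Qed.

Lemma mem_inner C I : interval I -> I \in C -> inner R C I.
Proof.
move=> iI IC; apply/innerP; split=> //; exists [fset I]%fset.
  by rewrite fsub1set.
split=> [p|J J' /fset1P -> /fset1P ->]; last by rewrite eqxx.
by split=> [Ip|[J /fset1P -> //]]; exists I => //; rewrite in_fset1.
Qed.

Lemma inner_trans D E I :
  (forall J, J \in D -> inner R E J) -> inner R D I -> inner R E I.
Proof.
move=> DE /innerP [iI [s sD [cov dis]]].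
have tile J : exists t : {fset zitv}, J \in s -> [/\ interval J, (t `<=` E)%fset,
    forall p, real_cl R J p <-> exists2 T, T \in t & real_cl R T p &
    forall T T', T \in t -> T' \in t -> T != T' ->
       (real_int R T `&` real_int R T')%classic = set0].
  have [Js|] := boolP (J \in s); last by exists fset0.
  have /innerP [iJ [t tE [c d]]] := DE _ (fsubsetP sD _ Js).
  by exists t.
have {tile} [t tP] := choice tile.
apply/innerP; split=> //; exists (\bigcup_(J <- s) t J)%fset.
  by apply/bigfcupsP => J Js _; have [] := tP _ Js.
have tsub J T : J \in s -> T \in t J -> (real_int R T `<=` real_int R J)%classic.
  move=> Js TJ p Tp; have [iJ _ c _] := tP _ Js.
  have iT : interval T.
    by case: Tp => a b c' d'; apply/andP; split; rewrite -(ler_int R) ltW //;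
      [apply: lt_trans a b | apply: lt_trans c' d'].
  by apply: (@int_sub J T iT _ p Tp) => q Tq; apply/c; exists T.
split=> [p|T T' /bigfcupP [J /andP [Js _] TJ] /bigfcupP [J' /andP [Js' _] TJ'] ne].
  rewrite cov; split=> [[J Js]|[T /bigfcupP [J /andP [Js _] TJ] Tp]].
    have [_ _ c _] := tP _ Js; rewrite c => -[T TJ Tp].
    by exists T => //; apply/bigfcupP; exists J => //; rewrite Js.
  by exists J => //; have [_ _ c _] := tP _ Js; apply/c; exists T.
have [eJ|nJ] := eqVneq J J'.
  by rewrite -eJ in TJ'; have [_ _ _ d] := tP _ Js; apply: d.
apply/seteqP; split=> // p [Tp T'p].
rewrite -(dis _ _ Js Js' nJ); split; first exact: (tsub J T).
exact: (tsub J' T').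
Qed.

Lemma inner_sub C D I : (C `<=` D)%fset -> inner R C I -> inner R D I.
Proof.
move=> CD /innerP [iI [s sC h]]; apply/innerP; split=> //; exists s => //.
exact: fsubset_trans CD.
Qed.

Lemma inner_verts C I : inner R C I -> (verts I `<=` vset C)%fset.
Proof.
move=> /innerP [iI [s sC [cov _]]].
have /andP [h1 h2] := iI.
have corner (x y : int) : x = I.1.1 \/ x = I.2.1 -> y = I.1.2 \/ y = I.2.2 ->
    (x, y) \in vset C.
  move=> hx hy.
  have [J Js [/= a b c d]] : exists2 J, J \in s & real_cl R J (x%:~R, y%:~R).
    by apply/cov; case: hx => hx; case: hy => hy; split; rewrite /= ler_int ?hx ?hy.
  have iJ : interval J by apply: (@cl_interval J (x%:~R, y%:~R)).
  have /(cl_sub _ iJ) /and4P [e f g h] : (real_cl R J `<=` real_cl R I)%classic.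
    by move=> q Jq; apply/cov; exists J.
  rewrite !ler_int in a b c d.
  have ex : x = J.1.1 \/ x = J.2.1.
    by case: hx => hx; [left|right]; apply: le_anti; apply/andP; split=> //;
      rewrite ?hx //; apply: le_trans; eassumption.
  have ey : y = J.1.2 \/ y = J.2.2.
    by case: hy => hy; [left|right]; apply: le_anti; apply/andP; split=> //;
      rewrite ?hy //; apply: le_trans; eassumption.
  apply/bigfcupP; exists J; first by rewrite (fsubsetP sC).
  case: J ex ey {Js a b c d e f g h iJ} => [[a b] [c d]] /= ex ey.
  by rewrite !inE /cornera /cornerb /cornerc /cornerd /=;
    case: ex => ->; case: ey => ->; rewrite !eqxx ?orbT.
apply/fsubsetP => -[x y]; case: I {iI h1 h2 cov} corner => [[i j] [k l]] /= corner.
rewrite !inE /cornera /cornerb /cornerc /cornerd /=.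
by move=> /orP [/orP [/orP [] |]|] /eqP [-> ->]; apply: corner; auto.
Qed.

Lemma inner_proper C I : (forall J, J \in C -> proper J) -> inner R C I -> proper I.
Proof.
move=> pC /innerP [iI [s sC [cov _]]]; have /andP [h1 h2] := iI.
have [J Js Jp] : exists2 J, J \in s & real_cl R J (I.1.1%:~R, I.1.2%:~R).
  by apply/cov; split; rewrite /= ler_int.
have /andP [p1 p2] := pC _ (fsubsetP sC _ Js).
have /(cl_sub _ (cl_interval Jp)) /and4P [a b c d] :
    (real_cl R J `<=` real_cl R I)%classic.
  by move=> q Jq; apply/cov; exists J.
apply/andP; split; first exact: le_lt_trans a (lt_le_trans p1 b).
exact: le_lt_trans c (lt_le_trans p2 d).
Qed.

Lemma proper_interval I : proper I -> interval I.
Proof. by move=> /andP [a b]; apply/andP; split; apply: ltW. Qed.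

Lemma generates_avoiding_exists C X : (forall I, I \in C -> proper I) ->
  exists D, generates_avoiding R C X D.
Proof.
move=> pC.
pose D0 := [fset I in ((vset C) `*` (vset C)) |
   `[< inner_avoiding R C X I >]]%fset.
have D0P I : I \in D0 <-> inner_avoiding R C X I.
  rewrite !inE /=; split=> [/andP [_ /asboolP //]|hI].
  apply/andP; split; last exact/asboolP.
  have [/inner_verts /fsubsetP vI _] := hI.
  by rewrite !vI // !inE /cornera /cornerb eqxx ?orbT.
have D0in : inner R D0 = inner_avoiding R C X.
  apply/seteqP; split=> I; last first.
    by move=> hI; apply: mem_inner; [have [[]]:= hI|apply/D0P].
  move=> hI; split.
    by apply: inner_trans hI => J /D0P [].
  have /fsubsetP vI := inner_verts hI.
  apply/eqP; rewrite -[_ == _]/([disjoint verts I & X]%fset).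
  apply/fdisjointP => a /vI /bigfcupP [J /andP [/D0P [_ hJ] _]].
  by move/eqP: hJ; rewrite -[_ == _]/([disjoint verts J & X]%fset) => /fdisjointP; apply.
pose P n := `[< exists D, [/\ #|` D| = n, (D `<=` D0)%fset &
   inner R D = inner_avoiding R C X] >].
have exP : exists n, P n by exists #|` D0|; apply/asboolP; exists D0.
case: (ex_minnP exP) => n /asboolP [D [cD DD0 Din]] nmin.
exists D; split=> //.
  move=> I /(fsubsetP DD0) /D0P [hI _]; exact: (inner_proper pC).
move=> I ID hI.
suff /nmin : P #|` (D `\ I)%fset|.
  by rewrite -cD (cardfsD1 I D) ID add1n ltnn.
apply/asboolP; exists (D `\ I)%fset; split=> //.
  exact: fsubset_trans (fsubD1set _ _) DD0.
rewrite -Din; apply/seteqP; split=> J.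
  exact: inner_sub (fsubD1set _ _).
apply: inner_trans => T TD.
have [->//|ne] := eqVneq T I.
have iT : interval T.
  by have [[]] := (D0P T).1 (fsubsetP DD0 _ TD).
by apply: mem_inner => //; rewrite !inE ne.
Qed.

Lemma generates_avoiding_sub C X D D' :
  generates_avoiding R C X D -> generates_avoiding R C X D' -> (D `<=` D')%fset.
Proof.
move=> [pD irr inD] [pD' _ inD']; apply/fsubsetP => I ID.
apply: contrapT => nID'.
have iI := proper_interval (pD _ ID).
have : inner R D' I by rewrite inD' -inD; apply: mem_inner.
move=> /innerP [_ [s sD' [cov dis]]].
apply: (irr I ID); apply: (@inner_trans s).
  move=> J Js.
  have iJ := proper_interval (pD' _ (fsubsetP sD' _ Js)).
  have : inner R D J.
    by rewrite inD -inD'; apply: mem_inner => //; apply: (fsubsetP sD').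
  move=> /innerP [_ [t tD [covt dist]]]; apply/innerP; split=> //.
  exists t => //; apply/fsubsetP => T Tt.
  rewrite !inE (fsubsetP tD) // andbT.
  apply: contraT => /negPn /eqP eT; rewrite eT in Tt; case: nID'.
  have /(cl_sub _ iI) /and4P [a b c d] : (real_cl R I `<=` real_cl R J)%classic.
    by move=> p Ip; apply/covt; exists I.
  have /(cl_sub _ iJ) /and4P [a' b' c' d'] : (real_cl R J `<=` real_cl R I)%classic.
    by move=> p Jp; apply/cov; exists J.
  suff -> : I = J by exact: (fsubsetP sD').
  case: I J a b c d a' b' c' d' {ID iI cov Js iJ covt Tt eT}
    => [[? ?] [? ?]] [[? ?] [? ?]] /= *.
  by congr (_, _); congr (_, _); apply: le_anti; apply/andP.
by apply/innerP; split=> //; exists s.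
Qed.

Lemma residualP C X : polyocollection C ->
  generates_avoiding R C X (residual R C X).
Proof.
move=> [pC _]; rewrite /residual.
have [D hD] := generates_avoiding_exists X pC.
by case: xgetP => [D' -> //|/(_ D)].
Qed.

Lemma polyocollection_residual C X D : polyocollection C ->
  polyocollection D -> inner R D = inner_avoiding R C X -> residual R C X = D.
Proof.
move=> hC [pD hD] inD.
have gD : generates_avoiding R C X D.
  split=> // I ID /innerP [_ [s sD [cov _]]].
  have /andP [h1 h2] := proper_interval (pD _ ID).
  have [J Js Jp] : exists2 J, J \in s & real_cl R J (I.1.1%:~R, I.1.2%:~R).
    by apply/cov; split; rewrite /= ler_int.
  have := fsubsetP sD _ Js; rewrite !inE => /andP [nJ JD].
  have [+ _] := hD _ _ JD ID nJ; apply.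
  have /(cl_sub _ (cl_interval Jp)) /and4P [a b c d] :
      (real_cl R J `<=` real_cl R I)%classic.
    by move=> q Jq; apply/cov; exists J.
  move=> q /andP [/andP [? ?] /andP [? ?]]; rewrite /pts /= /lep.
  by rewrite (le_trans a) // (le_trans c) // (le_trans _ b) // (le_trans _ d).
apply/eqP; rewrite eqEfsubset.
by rewrite (generates_avoiding_sub (residualP X hC) gD)
           (generates_avoiding_sub gD (residualP X hC)).
Qed.

Lemma cl_sub_pts I J : interval J ->
  (real_cl R J `<=` real_cl R I)%classic <-> (pts J `<=` pts I)%classic.
Proof.
move=> iJ; rewrite cl_sub //; split=> [/and4P [a b c d] q|sub].
  move=> /andP [/andP [? ?] /andP [? ?]]; rewrite /pts /= /lep.
  by rewrite (le_trans a) // (le_trans c) // (le_trans _ b) // (le_trans _ d).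
have /andP [h1 h2] := iJ.
have /andP [/andP [a c] _] : pts I J.1 by apply: sub; rewrite /pts /lep /= !lexx h1 h2.
have /andP [_ /andP [b d]] : pts I J.2 by apply: sub; rewrite /pts /lep /= !lexx h1 h2.
exact/and4P.
Qed.

Lemma pts_anti I J : interval I -> interval J ->
  (pts I `<=` pts J)%classic -> (pts J `<=` pts I)%classic -> I = J.
Proof.
move=> iI iJ /(cl_sub_pts _ iI) /(cl_sub _ iI) /and4P [a b c d].
move=> /(cl_sub_pts _ iJ) /(cl_sub _ iJ) /and4P [a' b' c' d'].
case: I J a b c d a' b' c' d' {iI iJ} => [[? ?] [? ?]] [[? ?] [? ?]] /= *.
by congr (_, _); congr (_, _); apply: le_anti; apply/andP.
Qed.

Lemma inner_tile C I : inner R C I ->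
  exists J, [/\ J \in C, interval J & (pts J `<=` pts I)%classic].
Proof.
move=> /innerP [/andP [h1 h2] [s sC [cov _]]].
have [J Js Jp] : exists2 J, J \in s & real_cl R J (I.1.1%:~R, I.1.2%:~R).
  by apply/cov; split; rewrite /= ler_int.
have iJ := cl_interval Jp.
exists J; split=> //; first exact: (fsubsetP sC).
by apply/(cl_sub_pts _ iJ) => q Jq; apply/cov; exists J.
Qed.

Lemma polyocollection_residual_minimal C X D : polyocollection D ->
  inner R D = inner_avoiding R C X ->
  forall I, I \in D <-> inner_avoiding R C X I /\
    forall J, inner_avoiding R C X J -> (pts J `<=` pts I)%classic -> J = I.
Proof.
move=> [pD hD] inD I; rewrite -inD; split=> [ID|[hI Imin]].
  have iI := proper_interval (pD _ ID).
  split=> [|J hJ JI]; first exact: mem_inner.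
  have [T [TD iT TJ]] := inner_tile hJ.
  have [eT|nT] := eqVneq T I.
    by rewrite eT in TJ; apply: pts_anti => //; case: hJ.
  by have [[]] := hD _ _ TD ID nT; apply: subset_trans JI.
have [T [TD iT TI]] := inner_tile hI.
by rewrite -(Imin T) //; apply: mem_inner.
Qed.

End ResidualSpec.


(* J_X *)
Definition J_ideal (R : realType) (K : fieldType) (C : {fset zitv})
    (X : {fset point}) : set (polyring K (vset C)) :=
  ideal_add
    (ideal_span [set var K (vset C) a | a in [set` X]]%classic)
    (ideal_ext (@var_incl K (vset (residual R C X)) (vset C))
       (lattice_ideal K (residual R C X))).

Arguments J_ideal R K C X : clear implicits.

(* Main.v *)
From HB Require Import structures.
Require Import Defs.
From mathcomp Require Import ring lra zify.

(** A common zero of [I_C] is classified by the set [X] of its vanishing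
    coordinates. A minor with a corner in [X] forces one of the two adjacent
    corners to vanish too, so [X] is admissible; the minors that survive are
    those of the inner intervals avoiding [X], and since the other coordinates
    are invertible they cut out the lattice ideal of the residual collection
    [C^(X)]. The components are therefore described by the ideals [J_X].

    The inclusion of the intersection of the [J_X] in the radical follows this
    sketch literally, with the primes containing [I_C] replaced by a finite case
    analysis: [radical_cases] reduces membership in a radical to the patterns
    in which each variable is either killed or made invertible. If the set [X] of
    killed variables is not admissible, the product of the invertible variables
    is nilpotent modulo [I_C] and [X] ([not_admissible_nilpotent]); otherwise
    [J_X] lies in the saturation of [I_C + (X)] with respect to that product
    ([J_ideal_saturation]).

    For the reverse inclusion, [J_X] has to be shown radical, which for a lattice
    ideal in every characteristic means that the lattice must be saturated.
    Here the lattice is even a direct summand with an explicit projection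
    ([reduce]), because the vectors [v_I], for [I] in [C^(X)], form a
    unitriangular system with respect to the lower left corners of the [I]. The
    projection gives a monomial map to a polynomial ring, a domain, which
    kills [I_C] ([toric_minor]) and whose kernel is contained in [J_X]
    ([toric_ker]).

    Unitriangularity requires distinct members of [C^(X)] to have distinct lower
    left corners ([irredundant_corner_inj]), and this is where the geometry
    enters. Members of a polyocollection that abut share a full edge, so the
    tilings of inner intervals are grids, and those of two inner intervals [I],
    [J] with the same lower left corner agree where they overlap. Hence the
    intersection [M] of [I] and [J] is inner ([inner_meet]); three of its corners
    are corners of [I] or [J], so by admissibility it avoids [X]. If [M] were
    smaller than [I], the line through its top or right side would be a grid line
    of [I] ([horizontal_cut], [vertical_cut]), cutting [I] into two inner
    intervals that avoid [X], and [I] would be redundant. *)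

Set Implicit Arguments.
Unset Strict Implicit.
Unset Printing Implicit Defensive.

Import Order.TTheory GRing.Theory Num.Theory.
Local Open Scope ring_scope.

(** * Ideals, radicals and saturations *)

Section IdealTheory.
Variable A : comNzRingType.
Implicit Types (G J : set A) (f g y : A).

Definition is_ideal J : Prop :=
  [/\ J 0, forall f g, J f -> J g -> J (f + g) & forall h f, J f -> J (h * f)].

Lemma ideal_span_ideal G : is_ideal (ideal_span G).
Proof.
split.
- by exists 0%N, (fun _ => 0), (fun _ => 0); split=> [[]|]; rewrite ?big_ord0.
- move=> _ _ [n [h [g [Gg ->]]]] [n' [h' [g' [Gg' ->]]]].
  exists (n + n')%N, (fun i => match split i with inl j => h j | inr j => h' j end),
    (fun i => match split i with inl j => g j | inr j => g' j end).
  split=> [i|]; first by case: (split i).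
  rewrite big_split_ord; congr (_ + _); apply: eq_bigr => i _ /=.
    by rewrite (unsplitK (inl i)).
  by rewrite (unsplitK (inr i)).
- move=> k _ [n [h [g [Gg ->]]]]; exists n, (fun i => k * h i), g; split=> //.
  by rewrite mulr_sumr; apply: eq_bigr => i _; rewrite mulrA.
Qed.

Lemma mem_ideal_span G g : G g -> ideal_span G g.
Proof.
by move=> Gg; exists 1%N, (fun _ => 1), (fun _ => g); rewrite big_ord1 mul1r.
Qed.

Lemma ideal_sum J (I : Type) (r : seq I) (P : pred I) (F : I -> A) :
  is_ideal J -> (forall i, P i -> J (F i)) -> J (\sum_(i <- r | P i) F i).
Proof. by move=> [J0 JD _] JF; apply: big_ind. Qed.

Lemma ideal_span_min G J : is_ideal J -> (forall g, G g -> J g) ->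
  forall f, ideal_span G f -> J f.
Proof.
move=> iJ GJ _ [n [h [g [Gg ->]]]]; apply: ideal_sum => // i _.
by have [_ _ JM] := iJ; apply/JM/GJ.
Qed.

Lemma ideal_span_sub G G' : (forall g, G g -> G' g) ->
  forall f, ideal_span G f -> ideal_span G' f.
Proof.
move=> GG'; apply: ideal_span_min; first exact: ideal_span_ideal.
by move=> g /GG'; apply: mem_ideal_span.
Qed.

Lemma idealMr J f h : is_ideal J -> J f -> J (f * h).
Proof. by move=> [_ _ JM] Jf; rewrite mulrC; apply: JM. Qed.

Lemma idealB J f g : is_ideal J -> J f -> J g -> J (f - g).
Proof.
by move=> [_ JD JM] Jf Jg; apply: JD => //; rewrite -mulN1r; apply: JM.
Qed.

Lemma ideal_add_ideal J J' : is_ideal J -> is_ideal J' -> is_ideal (ideal_add J J').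
Proof.
move=> [J0 JD JM] [J'0 J'D J'M]; split.
- by exists 0, 0; split; rewrite ?addr0.
- move=> _ _ [g [h [Jg Jh ->]]] [g' [h' [Jg' Jh' ->]]].
  by exists (g + g'), (h + h'); split; [exact: JD | exact: J'D | rewrite addrACA].
- move=> k _ [g [h [Jg Jh ->]]].
  by exists (k * g), (k * h); split; [exact: JM | exact: J'M | rewrite mulrDr].
Qed.

(** Modulo [G], some [g ^+ n] is a multiple [y * h]; if [m] is an exponent that
    kills [y * g], then [(y * h) ^+ m * g ^+ m = h ^+ m * (y * g) ^+ m] is 0. *)
Lemma radical_split G y g :
  radical (ideal_span (G `|` [set y])%classic) g ->
  radical (ideal_span G) (y * g) -> radical (ideal_span G) g.
Proof.
have iG := ideal_span_ideal G.
move=> [n n0 gn] [m m0 ygm].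
have [h gyh] : exists h, ideal_span G (g ^+ n - y * h).
  pose J := [set f | exists h, ideal_span G (f - y * h)]%classic.
  suff: J (g ^+ n) by [].
  apply: ideal_span_min gn; last first.
    move=> f [Gf|->]; last by exists 1; rewrite mulr1 subrr; case: iG.
    by exists 0; rewrite mulr0 subr0; apply: mem_ideal_span.
  have [G0 GD GM] := iG; split.
  - by exists 0; rewrite mulr0 subr0.
  - move=> f f' [h fh] [h' fh']; exists (h + h').
    by have := GD _ _ fh fh'; rewrite mulrDr addrACA opprD.
  - move=> k f [h fh]; exists (k * h).
    by have := GM k _ fh; rewrite mulrBr mulrCA.
exists (n * m + m)%N; first by rewrite addn_gt0 m0 orbT.
rewrite exprD exprM -(subrK ((y * h) ^+ m) (g ^+ n ^+ m)) mulrDl.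
have [_ GD GM] := iG; apply: GD.
  by rewrite subrXX -mulrA; apply: idealMr.
by rewrite exprMn mulrAC -exprMn mulrC; apply: GM.
Qed.

(** Iterating [radical_split]: as in a decomposition of a variety according to
    which of the coordinates [y t] vanish, it suffices to treat each pattern
    [P] of vanishing coordinates with the remaining ones made invertible. *)
Lemma radical_cases (T : eqType) (y : T -> A) (s : seq T) G g : uniq s ->
  (forall P : pred T,
     radical (ideal_span (G `|` [set y t | t in [set t | (t \in s) && P t]])%classic)
       ((\prod_(t <- s | ~~ P t) y t) * g)) ->
  radical (ideal_span G) g.
Proof.
elim: s G g => [|a s IH] G g /=.
  move=> _ /(_ pred0); rewrite big_nil mul1r => -[n n0 gn]; exists n => //.
  by apply: ideal_span_sub gn => f [//|[]].
move=> /andP [as_ us] hP.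
have neqa t : t \in s -> (t == a) = false.
  by move=> ts; apply: contraNF as_ => /eqP <-.
apply: (@radical_split _ (y a)); apply: IH => // P.
  have [n n0 hn] := hP (predU1 a P); exists n => //.
  rewrite big_cons /= eqxx /= in hn.
  rewrite (_ : \prod_(t <- s | ~~ P t) y t =
     \prod_(t <- s | ~~ ((t == a) || P t)) y t).
    apply: ideal_span_sub hn => f [Gf|[t /= /andP []]]; first by left; left.
    rewrite inE => /orP [/eqP -> _ <-|ts]; first by left; right.
    by rewrite /= neqa //= => Pt <-; right; exists t => //; apply/andP.
  by rewrite big_seq_cond [RHS]big_seq_cond; apply: eq_bigl => t;
    case ts: (t \in s) => //=; rewrite neqa.
have [n n0 hn] := hP (fun t => (t != a) && P t); exists n => //.
rewrite big_cons /= eqxx /= in hn.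
rewrite mulrCA mulrA.
rewrite (_ : \prod_(t <- s | ~~ P t) y t =
   \prod_(t <- s | ~~ ((t != a) && P t)) y t).
  apply: ideal_span_sub hn => f [Gf|[t /= /andP []]]; first by left.
  rewrite inE => /orP [/eqP -> |ts]; first by rewrite eqxx.
  by move=> /= /andP [_ Pt] <-; right; exists t => //; apply/andP.
by rewrite big_seq_cond [RHS]big_seq_cond; apply: eq_bigl => t;
  case ts: (t \in s) => //=; rewrite neqa.
Qed.

End IdealTheory.

Section Saturation.
Variables (A : comNzRingType) (Q : set A) (U : A).
Hypothesis iQ : is_ideal Q.

(** The kernel of the map from [A] to the localization of [A / Q] at [U]. *)
Definition saturation : set A := [set g | exists k, Q (U ^+ k * g)]%classic.

Lemma saturation_ideal : is_ideal saturation.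
Proof.
have [Q0 QD QM] := iQ; split.
- by exists 0%N; rewrite mulr0.
- move=> f g [k hf] [l hg]; exists (k + l)%N; rewrite mulrDr; apply: QD.
    by rewrite exprD [_ ^+ k * _]mulrC -mulrA; apply: QM.
  by rewrite exprD -mulrA; apply: QM.
- by move=> h f [k hf]; exists k; rewrite mulrCA; apply: QM.
Qed.

Lemma sub_saturation g : Q g -> saturation g.
Proof. by exists 0%N; rewrite expr0 mul1r. Qed.

Lemma saturation_cancel p g : (exists r, U = r * p) ->
  saturation (p * g) -> saturation g.
Proof.
move=> [r eU] [k hk]; exists k.+1; have [_ _ QM] := iQ.
by rewrite exprS {1}eU -!mulrA [p * _]mulrCA; apply: QM.
Qed.

Lemma saturation_radical g : saturation g -> radical Q (U * g).
Proof.
move=> [k hk]; exists k.+1 => //; have [_ _ QM] := iQ.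
have -> : (U * g) ^+ k.+1 = (U * g ^+ k) * (U ^+ k * g).
  by rewrite exprMn !exprS; ring.
exact: QM.
Qed.

End Saturation.

Lemma ideal_preim (A B : comNzRingType) (phi : {rmorphism A -> B}) (J : set B) :
  is_ideal J -> is_ideal [set p | J (phi p)]%classic.
Proof.
move=> [J0 JD JM]; split=> [|p q hp hq|h p hp] /=; first by rewrite rmorph0.
  by rewrite rmorphD; apply: JD.
by rewrite rmorphM; apply: JM.
Qed.

(** * Tilings in terms of unit cells *)

(** The unit cell with lower left corner [q] lies in [I]. *)
Definition cell (I : zitv) (q : point) : bool :=
  [&& I.1.1 <= q.1, q.1 < I.2.1, I.1.2 <= q.2 & q.2 < I.2.2].

(** Over the integers, a covering with disjoint interiors is a partition of
    the set of unit cells. *)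
Definition tiles (s : {fset zitv}) (I : zitv) : Prop :=
  (forall q, cell I q <-> exists2 T : zitv, T \in s & cell T q) /\
  (forall (T T' : zitv) q, T \in s -> T' \in s -> cell T q -> cell T' q -> T = T').

Section Cells.
Variable R : realType.
Implicit Types (I J T : zitv) (C : {fset zitv}) (q : point).

Definition center q : R * R := (q.1%:~R + 2^-1, q.2%:~R + 2^-1).

Lemma lez_half (i m : int) :
  (i%:~R <= m%:~R + 2^-1 :> R) = (i <= m) /\ (i%:~R < m%:~R + 2^-1 :> R) = (i <= m).
Proof.
have [im|mi] := leP i m.
  have : i%:~R <= m%:~R :> R by rewrite ler_int.
  by move=> h; split; apply/idP; lra.
have : (m + 1)%:~R <= i%:~R :> R by rewrite ler_int; lia.
by rewrite intrD => h; split; apply/negbTE; lra.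
Qed.

Lemma gez_half (i m : int) :
  (m%:~R + 2^-1 <= i%:~R :> R) = (m < i) /\ (m%:~R + 2^-1 < i%:~R :> R) = (m < i).
Proof.
have [mi|im] := ltP m i.
  have : (m + 1)%:~R <= i%:~R :> R by rewrite ler_int; lia.
  by rewrite intrD => h; split; apply/idP; lra.
have : i%:~R <= m%:~R :> R by rewrite ler_int.
by move=> h; split; apply/negbTE; lra.
Qed.

Lemma center_cl I q : real_cl R I (center q) <-> cell I q.
Proof.
rewrite /real_cl /cell /center /= !(lez_half _ _).1 !(gez_half _ _).1.
by split=> [[-> -> -> ->]|/and4P []].
Qed.

Lemma center_int I q : real_int R I (center q) <-> cell I q.
Proof.
rewrite /real_int /cell /center /= !(lez_half _ _).2 !(gez_half _ _).2.
by split=> [[-> -> -> ->]|/and4P []].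
Qed.

Lemma unit_interval (i k : int) (x : R) : i < k -> i%:~R <= x -> x <= k%:~R ->
  exists m : int, [/\ i <= m, m < k, m%:~R <= x & x <= (m + 1)%:~R].
Proof.
move=> ik ix xk; have /andP [fx xf] := Num.Theory.floor_itv x.
have [e|ne] := eqVneq x k%:~R.
  exists (k - 1); split; [lia | lia | | ].
    by rewrite e ler_int; lia.
  by rewrite e ler_int; lia.
exists (Num.floor x); split=> //; last exact: ltW.
  by rewrite Num.Theory.floor_ge_int.
by rewrite -(ltr_int R); apply: le_lt_trans fx _; rewrite lt_neqAle ne.
Qed.

Lemma cell_below I p : proper I -> real_cl R I p ->
  exists2 q, cell I q & forall J, cell J q -> real_cl R J p.
Proof.
move=> /andP [h1 h2] [a b c d].
have [m [m1 m2 m3 m4]] := unit_interval h1 a b.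
have [n [n1 n2 n3 n4]] := unit_interval h2 c d.
exists (m, n); first by rewrite /cell /= m1 m2 n1 n2.
move=> J /and4P /= [e f g h]; split.
- by apply: le_trans m3; rewrite ler_int.
- by apply: le_trans m4 _; rewrite ler_int; lia.
- by apply: le_trans n3; rewrite ler_int.
- by apply: le_trans n4 _; rewrite ler_int; lia.
Qed.

Lemma int_cell I p : real_int R I p -> cell I (Num.floor p.1, Num.floor p.2).
Proof.
move=> [a b c d]; apply/and4P; split; rewrite /=.
- by rewrite Num.Theory.floor_ge_int ltW.
- by rewrite Num.Theory.floor_lt_int.
- by rewrite Num.Theory.floor_ge_int ltW.
- by rewrite Num.Theory.floor_lt_int.
Qed.

Lemma cell_sub I J : proper J -> (forall q, cell J q -> cell I q) ->
  [&& I.1.1 <= J.1.1, J.2.1 <= I.2.1, I.1.2 <= J.1.2 & J.2.2 <= I.2.2].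
Proof.
move=> /andP [h1 h2] sub.
have : cell I J.1 by apply: sub; rewrite /cell; lia.
have : cell I (J.2.1 - 1, J.2.2 - 1) by apply: sub; rewrite /cell /=; lia.
rewrite /cell /=; lia.
Qed.

(** The centers of the cells detect both the covering and the disjointness of
    real intervals with integer corners; conversely a real point of a proper
    interval lies in the closure of one of its cells, also on the upper and right
    sides ([cell_below]). *)
Lemma inner_tiles C I : (forall J, J \in C -> proper J) ->
  inner R C I <-> proper I /\ exists2 s : {fset zitv}, (s `<=` C)%fset & tiles s I.
Proof.
move=> pC; split=> [hI|[pI [s sC [cov dis]]]].
  split; first exact: inner_proper hI.
  have /innerP [_ [s sC [cov dis]]] := hI; exists s => //; split=> [q|].
    split=> [/center_cl/cov [T Ts /center_cl Tq]|[T Ts Tq]]; first by exists T.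
    by apply/center_cl/cov; exists T => //; apply/center_cl.
  move=> T T' q Ts T's Tq T'q; apply: contrapT => /eqP ne.
  suff : (set0 : set (R * R)) (center q) by [].
  by rewrite -(dis _ _ Ts T's ne); split; apply/center_int.
apply/innerP; split; first exact: proper_interval.
exists s => //; split=> [p|T T' Ts T's ne].
  split=> [/(cell_below pI) [q /cov [T Ts Tq] qp]|[T Ts]].
    by exists T => //; apply: qp.
  have pT := pC _ (fsubsetP sC _ Ts).
  move: p; apply/(cl_sub _ _ (proper_interval pT))/cell_sub => // q Tq.
  by apply/cov; exists T.
apply/seteqP; split=> // p [/int_cell Tp /int_cell T'p].
by case/eqP: ne; apply: dis Tp T'p.
Qed.

End Cells.

(** * Tilings by members of a polyocollection *)

Section Geometry.
Implicit Types (I J M S T : zitv) (C s t : {fset zitv}) (p q : point).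

Lemma ptsE I p :
  pts I p = [&& I.1.1 <= p.1, I.1.2 <= p.2, p.1 <= I.2.1 & p.2 <= I.2.2] :> Prop.
Proof. by rewrite /pts /mkset /lep -!andbA. Qed.

Lemma edgesP I F : F \in edges I ->
  [\/ F = (I.1, (I.1.1, I.2.2)), F = (I.1, (I.2.1, I.1.2)),
      F = ((I.2.1, I.1.2), I.2) | F = ((I.1.1, I.2.2), I.2)].
Proof.
by rewrite !inE => /or4P [] /eqP ->; [apply: Or41|apply: Or42|apply: Or43|apply: Or44].
Qed.

Lemma polyo_proper C I : polyocollection C -> I \in C -> proper I.
Proof. by case=> h _; apply: h. Qed.

(** Both alternatives of the definition fail for two intervals issued from the
    same corner: their intersection is two-dimensional, and their left edges
    share a segment. *)
Lemma corner_inj C I J : polyocollection C ->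
  I \in C -> J \in C -> I.1 = J.1 -> I = J.
Proof.
move=> hC IC JC eIJ; apply: contrapT => /eqP ne.
have /andP [] := polyo_proper hC IC; have /andP [] := polyo_proper hC JC.
have [_] := hC.2 _ _ IC JC ne; move: eIJ {IC JC ne}.
case: I J => [[x y] [k l]] [[_ _] [k' l']] /= [<- <-] h pJ1 pJ2 pI1 pI2.
case: h => [[F [/edgesP FI FJ eF]]|h].
  have pF p : (pts ((x, y), (k, l)) `&` pts ((x, y), (k', l')))%classic p -> pts F p.
    by rewrite eF.
  have : pts F (x, y) by apply: pF; split; rewrite ptsE /=; lia.
  have : pts F (Order.min k k', Order.min l l').
    by apply: pF; split; rewrite ptsE /=; lia.
  by rewrite !ptsE; case: FI => -> /=; lia.
have sub1 := h ((x, y), (x, l)) ((x, y), (x, l')) (mem_head _ _) (mem_head _ _).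
have [] : (x, y) = (x, Order.min l l'); last by lia.
by apply: sub1; split; rewrite ptsE /=; lia.
Qed.

(** Two members that abut along a vertical segment share a whole edge: this is
    what forces the tilings by members of a polyocollection to be grids. *)
Lemma abutting_aligned C S T : polyocollection C -> S \in C -> T \in C ->
  S.2.1 = T.1.1 -> S.1.2 < T.2.2 -> T.1.2 < S.2.2 ->
  S.1.2 = T.1.2 /\ S.2.2 = T.2.2.
Proof.
move=> hC SC TC eST.
have /andP [] := polyo_proper hC SC; have /andP [] := polyo_proper hC TC.
have ne : S != T.
  have /andP [] := polyo_proper hC SC; have /andP [] := polyo_proper hC TC.
  by move=> a b c d; apply/eqP => e; move: eST; rewrite e; lia.
have [_] := hC.2 _ _ SC TC ne; move: eST {SC TC ne}.
case: S T => [[x y] [k l]] [[_ y'] [k' l']] /= <- h pT1 pT2 pS1 pS2 h1 h2.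
case: h => [[F [/edgesP FS /edgesP FT eF]]|h].
  have pF p : (pts ((x, y), (k, l)) `&` pts ((k, y'), (k', l')))%classic p -> pts F p.
    by rewrite eF.
  have : pts F (k, Order.max y y') by apply: pF; split; rewrite ptsE /=; lia.
  have : pts F (k, Order.min l l') by apply: pF; split; rewrite ptsE /=; lia.
  rewrite !ptsE; case: FS FT => -> /= [] [] *; lia.
have /= sub1 := h ((k, y), (k, l)) ((k, y'), (k, l')).
have [] : (k, Order.max y y') = (k, Order.min l l'); last by lia.
by apply: sub1; rewrite ?inE ?eqxx ?orbT //; split; rewrite ptsE /=; lia.
Qed.

Lemma tile_sub C I s T : polyocollection C -> (s `<=` C)%fset -> tiles s I -> T \in s ->
  [&& I.1.1 <= T.1.1, T.2.1 <= I.2.1, I.1.2 <= T.1.2 & T.2.2 <= I.2.2].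
Proof.
move=> hC sC [cov _] Ts.
apply: cell_sub; first exact: (polyo_proper hC (fsubsetP sC _ Ts)).
by move=> q Tq; apply/cov; exists T.
Qed.

Lemma cell_corner S : proper S -> cell S S.1.
Proof. by rewrite /cell /proper; lia. Qed.

Lemma cell_between I J S q : I.1 = J.1 ->
  cell J q -> cell S q -> cell I S.1 -> cell S S.1 -> cell J S.1.
Proof. by move=> e; rewrite /cell e; lia. Qed.

Lemma corner_closer I S q : cell I q -> cell S q -> cell I S.1 -> S.1 != q ->
  (absz ((S.1.1 - I.1.1) + (S.1.2 - I.1.2))%R <
   absz ((q.1 - I.1.1) + (q.2 - I.1.2))%R)%N.
Proof.
rewrite /cell; case: I S q => [[? ?] [? ?]] [[a b] [? ?]] [c d] /=.
rewrite xpair_eqE; lia.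
Qed.

(** Tilings of two intervals issued from the same corner agree on the overlap:
    reading the cells away from that corner, the next tile is determined by its
    own lower left corner. *)
Lemma tilings_agree C I J s t q S T : polyocollection C ->
  (s `<=` C)%fset -> (t `<=` C)%fset -> tiles s I -> tiles t J -> I.1 = J.1 ->
  cell I q -> cell J q -> S \in s -> T \in t -> cell S q -> cell T q -> S = T.
Proof.
move=> hC sC tC hs ht eIJ.
have [n] := ubnP (absz ((q.1 - I.1.1) + (q.2 - I.1.2))).
elim: n q S T => // n IH q S T le_n Iq Jq Ss Tt Sq Tq.
have pS := polyo_proper hC (fsubsetP sC _ Ss).
have pT := polyo_proper hC (fsubsetP tC _ Tt).
have SS := cell_corner pS; have TT := cell_corner pT.
(* If [S] starts before [q], the induction hypothesis at its first cell identifies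
   it with a member of [t], which covers [q] as well. *)
have [eS|neS] := eqVneq S.1 q; last first.
  have IS : cell I S.1 by apply/hs.1; exists S.
  have JS : cell J S.1 by move: eIJ Jq Sq IS SS; apply: cell_between.
  have [S' S't S'S] := (ht.1 _).1 JS.
  have eS' : S = S'.
    apply: (IH S.1) => //; apply: leq_trans (corner_closer Iq Sq IS neS) _.
    by rewrite -ltnS.
  by apply: (ht.2 _ _ q) => //; rewrite eS'.
have [eT|neT] := eqVneq T.1 q; last first.
  have JT : cell J T.1 by apply/ht.1; exists T.
  have IT : cell I T.1 by move: (esym eIJ) Iq Tq JT TT; apply: cell_between.
  have [T' T's T'T] := (hs.1 _).1 IT.
  have eT' : T' = T.
    apply: (IH T.1) => //; apply: leq_trans (corner_closer Iq Tq IT neT) _.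
    by rewrite -ltnS.
  by apply: (hs.2 _ _ q) => //; rewrite -eT'.
by apply: (corner_inj hC (fsubsetP sC _ Ss) (fsubsetP tC _ Tt)); rewrite eS eT.
Qed.

(** The tiles adjacent on the left to a tile crossed by the line would be
    crossed too, up to the left side of [I], where the tile below the line is [T0]. *)
Lemma uncrossed_line C I s T0 T : polyocollection C -> (s `<=` C)%fset -> tiles s I ->
  T0 \in s -> T0.1.1 = I.1.1 -> T \in s -> T.1.2 < T0.2.2 -> T0.2.2 <= T.2.2 ->
  T.2.2 = T0.2.2.
Proof.
move=> hC sC hs T0s eT0.
have pr (U : zitv) := fun (Us : U \in s) => polyo_proper hC (fsubsetP sC _ Us).
have sub (U : zitv) := fun (Us : U \in s) => tile_sub hC sC hs Us.
have /andP [p01 p02] := pr _ T0s.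
have [n] := ubnP (absz (T.1.1 - I.1.1)); elim: n T => // n IH T le_n Ts h1 h2.
have [e|ne] := eqVneq T.1.1 I.1.1.
  have /andP [p1 p2] := pr _ Ts.
  suff -> : T = T0 by [].
  by apply: (hs.2 _ _ (I.1.1, T0.2.2 - 1)) => //; rewrite /cell /=; lia.
have subT := sub _ Ts.
have subT0 := sub _ T0s.
have /andP [p1 p2] := pr _ Ts.
(* [T'] covers the cell to the left of [T] just below the line. *)
have [T' T's T'q] : exists2 T' : zitv, T' \in s & cell T' (T.1.1 - 1, T0.2.2 - 1).
  by apply/(hs.1 _).1; rewrite /cell /=; lia.
have eT' : T'.2.1 = T.1.1.
  have [//|ne'] := eqVneq T'.2.1 T.1.1.
  have eTT' : T = T'.
    apply: (hs.2 _ _ (T.1.1, T0.2.2 - 1)) => //; move: T'q; rewrite /cell /=; lia.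
  by move: T'q; rewrite -eTT' /cell /=; lia.
have /andP [p1' p2'] := pr _ T's; have subT' := sub _ T's.
have [e1 e2] : T'.1.2 = T.1.2 /\ T'.2.2 = T.2.2.
  by apply: (abutting_aligned hC (fsubsetP sC _ T's) (fsubsetP sC _ Ts) eT');
    move: T'q; rewrite /cell /=; lia.
by rewrite -e2; apply: IH => //; lia.
Qed.

Variable R : realType.

(** The tiles common to both tilings tile the intersection. *)
Lemma inner_meet C I J : polyocollection C -> inner R C I -> inner R C J ->
  I.1 = J.1 -> inner R C (I.1, (Order.min I.2.1 J.2.1, Order.min I.2.2 J.2.2)).
Proof.
move=> hC; have pC := fun K => @polyo_proper C K hC.
move=> /(inner_tiles R _ pC) [pI [s sC hs]] /(inner_tiles R _ pC) [pJ [t tC ht]] eIJ.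
have e1 : I.1.1 = J.1.1 by rewrite eIJ.
have e2 : I.1.2 = J.1.2 by rewrite eIJ.
apply/(inner_tiles R _ pC); split; first by move: pI pJ; rewrite /proper /=; lia.
exists (s `&` t)%fset; first exact: fsubset_trans (fsubsetIl _ _) sC.
split=> [q|T T' q /fsetIP [Ts _] /fsetIP [T's _]]; last exact: hs.2.
have -> : cell (I.1, (Order.min I.2.1 J.2.1, Order.min I.2.2 J.2.2)) q
    = cell I q && cell J q by rewrite /cell /=; lia.
split=> [/andP [Iq Jq]|[T /fsetIP [Ts Tt] Tq]].
  have [S Ss Sq] := (hs.1 _).1 Iq; have [T Tt Tq] := (ht.1 _).1 Jq.
  exists S => //; rewrite in_fsetI Ss /=.
  by rewrite (tilings_agree hC sC tC hs ht eIJ Iq Jq Ss Tt Sq Tq).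
by apply/andP; split; [apply/hs.1|apply/ht.1]; exists T.
Qed.

(** The top line of [M] starts on the left side of [I] along a tile common to
    both, hence crosses no tile of [I]. *)
Lemma horizontal_cut C I M : polyocollection C -> inner R C I -> inner R C M ->
  M.1 = I.1 -> M.2.1 <= I.2.1 -> M.2.2 < I.2.2 ->
  inner R C (I.1, (I.2.1, M.2.2)) /\ inner R C ((I.1.1, M.2.2), I.2).
Proof.
move=> hC; have pC := fun K => @polyo_proper C K hC.
move=> /(inner_tiles R _ pC) [pI [s sC hs]].
move=> /(inner_tiles R _ pC) [pM [t tC ht]] eM le1 lt2.
have e1 : M.1.1 = I.1.1 by rewrite eM.
have e2 : M.1.2 = I.1.2 by rewrite eM.
have /andP [pI1 pI2] := pI; have /andP [pM1 pM2] := pM.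
(* The cell in the upper left corner of [M]: its tile [T0] ends on the line. *)
have Iq : cell I (I.1.1, M.2.2 - 1) by rewrite /cell /=; lia.
have Mq : cell M (I.1.1, M.2.2 - 1) by rewrite /cell /=; lia.
have [T0 T0s T0q] := (hs.1 _).1 Iq; have [T1 T1t T1q] := (ht.1 _).1 Mq.
have eT := tilings_agree hC sC tC hs ht (esym eM) Iq Mq T0s T1t T0q T1q.
have subI := tile_sub hC sC hs T0s.
have := tile_sub hC tC ht T1t; rewrite -eT => subM.
have eT0 : T0.1.1 = I.1.1 by move: T0q subI; clear; rewrite /cell /=; lia.
have eT2 : T0.2.2 = M.2.2 by move: T0q subM; clear; rewrite /cell /=; lia.
have uncr T : T \in s -> T.2.2 <= M.2.2 \/ M.2.2 <= T.1.2.
  move=> Ts; have := uncrossed_line hC sC hs T0s eT0 Ts; rewrite eT2.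
  case: (leP T.2.2 M.2.2) => h1; first by left.
  case: (leP M.2.2 T.1.2) => h2; first by right.
  by move=> /(_ isT (ltW h1)) e; move: h1; rewrite e ltxx.
have M_low : M.2.2 > I.1.2 by rewrite -e2.
split; apply/(inner_tiles R _ pC).
  split; first by rewrite /proper /= pI1 M_low.
  exists [fset T in s | T.2.2 <= M.2.2]%fset.
    by apply: fsubset_trans sC; apply: fset_sub.
  split=> [q|T T' q]; last by rewrite !inE => /andP [Ts _] /andP [T's _]; apply: hs.2.
  split=> [hq|[T]].
    have /hs.1 [T Ts Tq] : cell I q.
    by move: hq M_low lt2; clear; rewrite /cell /=; lia.
    exists T => //; rewrite !inE Ts /=.
    by have [//|] := uncr _ Ts; move: hq Tq; clear; rewrite /cell /=; lia.
  rewrite !inE => /andP [Ts h] Tq.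
  have : cell I q by apply/hs.1; exists T.
  by move: Tq h; clear; rewrite /cell /=; lia.
split; first by rewrite /proper /= pI1 lt2.
exists [fset T in s | M.2.2 <= T.1.2]%fset.
  by apply: fsubset_trans sC; apply: fset_sub.
split=> [q|T T' q]; last by rewrite !inE => /andP [Ts _] /andP [T's _]; apply: hs.2.
split=> [hq|[T]].
  have /hs.1 [T Ts Tq] : cell I q.
    by move: hq M_low lt2; clear; rewrite /cell /=; lia.
  exists T => //; rewrite !inE Ts /=.
  by have [|//] := uncr _ Ts; move: hq Tq; clear; rewrite /cell /=; lia.
rewrite !inE => /andP [Ts h] Tq.
have : cell I q by apply/hs.1; exists T.
by move: Tq h; clear; rewrite /cell /=; lia.
Qed.

Definition flip_pt p : point := (p.2, p.1).
(** Reflection in the diagonal, which exchanges horizontal and vertical cuts. *)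
Definition flip I : zitv := (flip_pt I.1, flip_pt I.2).

Lemma flip_ptK : involutive flip_pt. Proof. by case. Qed.
Lemma flipK : involutive flip. Proof. by case=> [[? ?] [? ?]]. Qed.

Lemma pts_flip I p : pts (flip I) p = pts I (flip_pt p).
Proof. by rewrite !ptsE /=; congr (is_true _); lia. Qed.

Lemma cell_flip I q : cell (flip I) q = cell I (flip_pt q).
Proof. by rewrite /cell /=; lia. Qed.

Lemma edges_flip I F : F \in edges (flip I) -> flip F \in edges I.
Proof.
case: I F => [[? ?] [? ?]] F; rewrite !inE.
by case/or4P => /eqP ->; rewrite /flip /= eqxx ?orbT.
Qed.

Lemma polyocollection_flip C : polyocollection C ->
  polyocollection [fset flip I | I in C]%fset.
Proof.
move=> [pC hC]; split=> [_ /imfsetP [I IC ->]|].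
  by have /andP [a b] := pC _ IC; apply/andP.
move=> _ _ /imfsetP [I IC ->] /imfsetP [J JC ->] ne.
have neIJ : I != J by apply: contra_neq ne => ->.
have [nsub h] := hC _ _ IC JC neIJ; split.
  apply: contra_not nsub => sub p.
  by have := sub (flip_pt p); rewrite !pts_flip flip_ptK.
case: h => [[F [FI FJ eF]]|h]; [left|right].
  exists (flip F); split; try by apply: edges_flip; rewrite flipK.
  by apply/seteqP; split=> p; rewrite /setI /mkset !pts_flip -eF.
move=> F G /edges_flip FI /edges_flip GJ p q [p1 p2] [q1 q2].
apply: (can_inj flip_ptK); apply: (h _ _ FI GJ); split; by rewrite pts_flip flip_ptK.
Qed.

Lemma inner_flip C I : polyocollection C -> inner R C I ->
  inner R [fset flip I | I in C]%fset (flip I).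
Proof.
move=> hC; have hC' := polyocollection_flip hC.
move=> /(inner_tiles R _ (fun K => @polyo_proper C K hC)) [/andP [p1 p2] [s sC hs]].
apply/(inner_tiles R _ (fun K => @polyo_proper _ K hC')).
split; first exact/andP.
exists [fset flip T | T in s]%fset.
  by apply/fsubsetP => _ /imfsetP [T Ts ->]; apply/in_imfset/(fsubsetP sC).
split=> [q|_ _ q /imfsetP [T Ts ->] /imfsetP [T' T's ->]]; rewrite !cell_flip.
  split=> [/hs.1 [T Ts Tq]|[_ /imfsetP [T Ts ->]]].
    by exists (flip T); rewrite ?cell_flip //; apply: in_imfset.
  by rewrite cell_flip => Tq; apply/hs.1; exists T.
by move=> Tq T'q; congr flip; apply: hs.2 Tq T'q.
Qed.

Lemma vertical_cut C I M : polyocollection C -> inner R C I -> inner R C M ->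
  M.1 = I.1 -> M.2.2 <= I.2.2 -> M.2.1 < I.2.1 ->
  inner R C (I.1, (M.2.1, I.2.2)) /\ inner R C ((M.2.1, I.1.2), I.2).
Proof.
move=> hC hI hM eM le2 lt1; have hC' := polyocollection_flip hC.
have CC : [fset flip I | I in [fset flip I | I in C]]%fset = C.
  apply/fsetP => K; apply/imfsetP/idP => [[_ /imfsetP [L LC ->] ->]|KC].
    by rewrite flipK.
  by exists (flip K); rewrite ?flipK //; apply: in_imfset.
have [] := horizontal_cut hC' (inner_flip hC hI) (inner_flip hC hM) _ le2 lt1.
  by rewrite /flip /= eM.
move=> /(inner_flip hC') + /(inner_flip hC'); rewrite CC.
by case: I {hI eM le2 lt1} => [[? ?] [? ?]].
Qed.

(** * Lower left corners in the residual collection *)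

Lemma vertsP I p : p \in verts I =
  [|| p == I.1, p == I.2, p == (I.1.1, I.2.2) | p == (I.2.1, I.1.2)].
Proof. by rewrite !inE -!orbA. Qed.

(** An inner interval with three corners outside of an admissible set has all of
    them outside, since each edge meets any three corners. *)
Lemma avoiding_of_corners C X I p : polyocollection C -> admissible R C X ->
  inner R C I -> (forall q, q \in verts I -> q != p -> q \notin X) ->
  inner_avoiding R C X I.
Proof.
move=> hC [_ admX] hI hp; split=> //; have [e|[F FI hF]] := admX _ hI.
  by rewrite fsetIC.
have /andP [pI1 pI2] := inner_proper (fun K => @polyo_proper C K hC) hI.
have neF : F.1 != F.2.
  by case: (edgesP FI) => ->; apply/eqP; case: (I) pI1 pI2 => [[? ?] [? ?]] /= ? ? [];
     lia.
have inX q : q \in boundary F -> q \in X /\ q \in verts I.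
  by move=> /(fsubsetP hF) /fsetIP.
have [X1 v1] : F.1 \in X /\ F.1 \in verts I by apply: inX; rewrite !inE eqxx.
have [X2 v2] : F.2 \in X /\ F.2 \in verts I by apply: inX; rewrite !inE eqxx orbT.
have [e|n1] := eqVneq F.1 p; last by have := hp _ v1 n1; rewrite X1.
by have := hp _ v2; rewrite X2 -e eq_sym neF => /(_ isT).
Qed.

Lemma avoiding_notin C X I p :
  inner_avoiding R C X I -> p \in verts I -> p \notin X.
Proof.
move=> [_ e] pI; apply/negP => pX.
by have : p \in (verts I `&` X)%fset; [rewrite in_fsetI pI|rewrite e in_fset0].
Qed.

Lemma avoiding_corners C X I : inner_avoiding R C X I ->
  [/\ I.1 \notin X, I.2 \notin X, (I.1.1, I.2.2) \notin X & (I.2.1, I.1.2) \notin X].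
Proof.
by move=> h; split; apply: (avoiding_notin h); rewrite vertsP eqxx ?orbT.
Qed.

Lemma tiles_pair I I1 I2 :
  (forall q, cell I q = cell I1 q || cell I2 q) ->
  (forall q, ~~ (cell I1 q && cell I2 q)) -> tiles [fset I1; I2]%fset I.
Proof.
move=> cov dis; split=> [q|T T' q].
  rewrite cov; split=> [/orP [] h|[T]]; first by exists I1; rewrite ?inE ?eqxx.
    by exists I2; rewrite ?inE ?eqxx ?orbT.
  by rewrite !inE => /orP [] /eqP -> ->; rewrite ?orbT.
rewrite !inE => /orP [] /eqP -> /orP [] /eqP -> // h1 h2; have := dis q.
  by rewrite h1 h2.
by rewrite h1 h2.
Qed.

(** Each of the two pieces misses a cell of [I], so its tiling by members of [D]
    does not involve [I]; together these tilings express [I] by other members. *)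
Lemma reducible C X D I I1 I2 : polyocollection C ->
  generates_avoiding R C X D -> I \in D ->
  inner_avoiding R C X I1 -> inner_avoiding R C X I2 ->
  (forall q, cell I q = cell I1 q || cell I2 q) ->
  (forall q, ~~ (cell I1 q && cell I2 q)) -> False.
Proof.
move=> hC [pD irrD inD] ID h1 h2 cov dis.
have pI := pD _ ID.
have pI1 := inner_proper (fun K => @polyo_proper C K hC) h1.1.
have pI2 := inner_proper (fun K => @polyo_proper C K hC) h2.1.
have part K K' : inner R D K -> proper K' -> (forall q, cell K q -> cell I q) ->
    (forall q, cell K' q -> cell I q) -> (forall q, ~~ (cell K q && cell K' q)) ->
    inner R (D `\ I)%fset K.
  move=> /(inner_tiles R _ pD) [pK [s sD hs]] pK' KI K'I disK.
  have pDI T : T \in (D `\ I)%fset -> proper T by rewrite !inE => /andP [_ /pD].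
  apply/(inner_tiles R _ pDI); split=> //; exists s => //.
  apply/fsubsetP => T Ts; rewrite !inE (fsubsetP sD) // andbT.
  apply/eqP => eT; have K'c := cell_corner pK'.
  have := disK K'.1; rewrite K'c andbT => /negP; apply.
  by apply/hs.1; exists T; rewrite ?Ts // eT; apply: K'I.
have hp : forall J, J \in [fset I1; I2]%fset -> proper J.
  by move=> J; rewrite !inE => /orP [] /eqP ->.
apply: (irrD I ID); apply: (@inner_trans R [fset I1; I2]%fset).
  have c1 q : cell I1 q -> cell I q by rewrite cov => ->.
  have c2 q : cell I2 q -> cell I q by rewrite cov orbC => ->.
  move=> J; rewrite !inE => /orP [] /eqP ->.
    by apply: part pI2 c1 c2 dis; rewrite inD.
  by apply: part pI1 c2 c1 _; rewrite ?inD // => q; rewrite andbC.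
apply/(inner_tiles R _ hp); split=> //.
by exists [fset I1; I2]%fset; [exact: fsubset_refl | exact: tiles_pair].
Qed.

(** A smaller [M] has its top or right side inside [I]. The line through the top side
    cuts off a lower piece of [I] whose upper right corner alone can differ from the
    corners of [I] and [M], so this piece avoids [X] by admissibility, and then so
    does the upper piece. When the tops agree, the left piece is [M] itself. *)
Lemma irredundant_corner_min C X D I M : polyocollection C -> admissible R C X ->
  generates_avoiding R C X D -> I \in D -> inner_avoiding R C X M ->
  M.1 = I.1 -> M.2.1 <= I.2.1 -> M.2.2 <= I.2.2 -> M = I.
Proof.
move=> hC admX gD ID hM eM le1 le2.
have [pD _ inD] := gD.
have hI : inner_avoiding R C X I.
  by rewrite -inD; apply: mem_inner => //; apply/proper_interval/pD.
have /andP [pM1 pM2] := inner_proper (fun K => @polyo_proper C K hC) hM.1.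
have [I1 I2 I3 I4] := avoiding_corners hI.
have [M1 M2 M3 M4] := avoiding_corners hM.
have three K p : inner R C K -> (forall q, q \in verts K -> q != p -> q \notin X) ->
  inner_avoiding R C X K := avoiding_of_corners hC admX.
have [lt2|ge2] := ltP M.2.2 I.2.2.
  exfalso; have [h1 h2] := horizontal_cut hC hI.1 hM.1 eM le1 lt2.
  have a1 : inner_avoiding R C X (I.1, (I.2.1, M.2.2)).
    apply: (three _ (I.2.1, M.2.2)) => // q.
    rewrite vertsP /= => /or4P [] /eqP -> //; rewrite ?eqxx // => _.
    by rewrite -eM.
  have a2 : inner_avoiding R C X ((I.1.1, M.2.2), I.2).
    have [_ h _ _] := avoiding_corners a1.
    split=> //; apply/eqP.
    rewrite -[_ == _]/([disjoint verts ((I.1.1, M.2.2), I.2) & X]%fset).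
    apply/fdisjointP => q; rewrite vertsP /= => /or4P [] /eqP -> //.
    by rewrite -eM.
  move: pM1 pM2 eM le1 lt2 (reducible hC gD ID a1 a2); clear; rewrite /cell.
  case: I M => [[x y] [k l]] [[x' y'] [k' l']] /= pM1 pM2 [e1 e2] le1 lt2.
  by apply=> -[a b] /=; lia.
have e2 : M.2.2 = I.2.2 by lia.
have [lt1|ge1] := ltP M.2.1 I.2.1; last first.
  have e1 : M.2.1 = I.2.1 by lia.
  by case: (M) (I) eM e1 e2 => [? [? ?]] [? [? ?]] /= -> -> ->.
exfalso; have [h1 h2] := vertical_cut hC hI.1 hM.1 eM le2 lt1.
have a2 : inner_avoiding R C X ((M.2.1, I.1.2), I.2).
  split=> //; apply/eqP.
  rewrite -[_ == _]/([disjoint verts ((M.2.1, I.1.2), I.2) & X]%fset).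
  apply/fdisjointP => q; rewrite vertsP /= => /or4P [] /eqP -> //.
    by rewrite -eM.
  by rewrite -e2; case: (M.2) M2.
move: pM1 pM2 eM le1 e2 lt1 (reducible hC gD ID hM a2); clear; rewrite /cell.
case: I M => [[x y] [k l]] [[x' y'] [k' l']] /= pM1 pM2 [e1 e2] le1 -> lt2.
by apply=> -[a b] /=; lia.
Qed.

(** Two members with the same lower left corner would both equal their
    intersection. *)
Lemma irredundant_corner_inj C X D I J : polyocollection C -> admissible R C X ->
  generates_avoiding R C X D -> I \in D -> J \in D -> I.1 = J.1 -> I = J.
Proof.
move=> hC admX gD ID JD eIJ; have [pD _ inD] := gD.
have hin K : K \in D -> inner_avoiding R C X K.
  by move=> KD; rewrite -inD; apply: mem_inner => //; apply/proper_interval/pD.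
set M := (I.1, (Order.min I.2.1 J.2.1, Order.min I.2.2 J.2.2)).
have hM : inner_avoiding R C X M.
  apply: (avoiding_of_corners hC admX (p := M.2)).
    exact: inner_meet (hin _ ID).1 (hin _ JD).1 eIJ.
  have [I1 _ I3 I4] := avoiding_corners (hin _ ID).
  have [J1 _ J3 J4] := avoiding_corners (hin _ JD).
  move=> q; rewrite vertsP /= => /or4P [] /eqP -> //=; rewrite ?eqxx // => _.
    by rewrite minElt; case: ifP => _ //; rewrite eIJ.
  by rewrite minElt; case: ifP => _ //; rewrite eIJ.
have eI : M = I by apply: (irredundant_corner_min hC admX gD) => //=; lia.
by rewrite -eI; apply: (irredundant_corner_min hC admX gD) => //=; lia.
Qed.
End Geometry.

(** * Splitting off the lattice *)

Section Exponents.
Variable W : {fset point}.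
Implicit Types (e : {ffun W -> int}) (I J T : zitv) (s : seq zitv).

Lemma step_diff (i k x : int) : i <= k ->
  (i <= x < k)%R%:Z - (i <= x - 1 < k)%R%:Z = (x == i)%:Z - (x == k)%:Z.
Proof. by move=> h; lia. Qed.

(** [v_I] is the mixed second difference of the indicator function of the cells
    of [I]; thus relations between the [v_I] can be read off from tilings. *)
Lemma zvec_itv_cell I (u : W) : interval I -> let p := val u in
  zvec_itv W I u = (cell I p)%:Z - (cell I ((p.1 - 1)%R, p.2))%:Z
    - (cell I (p.1, (p.2 - 1)%R))%:Z + (cell I (p.1 - 1, p.2 - 1)%R)%:Z.
Proof.
move=> /andP [h1 h2] p; rewrite !ffunE /= -/p.
have andz (a b : bool) : (a && b)%:Z = a%:Z * b%:Z by case: a b => [] [].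
have cellE x y : (cell I (x, y))%:Z =
    (I.1.1 <= x < I.2.1)%R%:Z * (I.1.2 <= y < I.2.2)%R%:Z.
  by rewrite -andz /cell /= andbA.
have := step_diff p.1 h1; have := step_diff p.2 h2.
case: p => x y /=; rewrite !cellE !xpair_eqE !andz /=.
rewrite /cornera /cornerb /cornerc /cornerd.
case: I {h1 h2 cellE} => [[i j] [k l]] /= hy hx.
transitivity (((x == i)%:Z - (x == k)%:Z) * ((y == j)%:Z - (y == l)%:Z)); first by ring.
by rewrite -hx -hy; ring.
Qed.

Lemma zvec_itv_tiles (s : {fset zitv}) I : (forall T, T \in s -> proper T) ->
  proper I -> tiles s I -> zvec_itv W I = \sum_(T <- s) zvec_itv W T.
Proof.
move=> ps pI [cov dis].
have cellE q : (cell I q)%:Z = \sum_(T <- s) (cell T q)%:Z.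
  have [/cov [T Ts Tq]|nIq] := boolP (cell I q).
    rewrite (bigD1_seq T) ?fset_uniq //= Tq big_seq_cond big1 ?addr0 //.
    move=> T' /andP [T's ne]; have [T'q|//] := boolP (cell T' q).
    by rewrite (dis _ _ _ T's Ts T'q Tq) eqxx in ne.
  rewrite big_seq big1 // => T Ts; have [Tq|//] := boolP (cell T q).
  by case/negP: nIq; apply/cov; exists T.
apply/ffunP => u; rewrite sum_ffunE zvec_itv_cell ?proper_interval //.
rewrite !cellE -!sumrB -big_split /= big_seq [RHS]big_seq.
by apply: eq_bigr => T /ps /proper_interval iT; rewrite zvec_itv_cell.
Qed.

(** Corners are points of the plane, whereas exponent vectors are indexed by [W];
    this total evaluation avoids carrying membership proofs. *)
Definition coef e (a : point) : int := if insub a is Some u then e u else 0.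

Lemma coefB e e' a : coef (e - e') a = coef e a - coef e' a.
Proof. by rewrite /coef; case: insubP => [u _ _|_]; rewrite ?subr0 // !ffunE. Qed.

Lemma coef_val e (u : W) : coef e (val u) = e u.
Proof. by rewrite /coef valK. Qed.

(** Gaussian elimination with the lower left corners as pivots. *)
Definition reduce s e : {ffun W -> int} :=
  foldl (fun e I => e - zvec_itv W I *~ coef e I.1) e s.

Lemma reduce_cons I s e :
  reduce (I :: s) e = reduce s (e - zvec_itv W I *~ coef e I.1).
Proof. by []. Qed.

Lemma reduceB s : {morph reduce s : e e' / e - e'}.
Proof.
elim: s => [|I s IH] e e'; first by [].
rewrite !reduce_cons -IH coefB mulrzBr; congr reduce.
by rewrite !opprB addrACA [RHS]addrACA; congr (_ + _); rewrite addrC.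
Qed.
HB.instance Definition _ s :=
  GRing.isZmodMorphism.Build {ffun W -> int} {ffun W -> int} (reduce s) (reduceB s).

Definition zspan s e : Prop :=
  exists c : zitv -> int, e = \sum_(I <- s) zvec_itv W I *~ c I.

Lemma reduce_span s e : uniq s -> zspan s (e - reduce s e).
Proof.
elim: s e => [|I s IH] e /=.
  by exists (fun _ => 0); rewrite big_nil subrr.
move=> /andP [Is us]; have [c hc] := IH (e - zvec_itv W I *~ coef e I.1) us.
exists (fun J => if J == I then coef e I.1 else c J).
rewrite big_cons eqxx big_seq.
rewrite (eq_bigr (fun J => zvec_itv W J *~ c J)) -?big_seq -?hc; last first.
  by move=> J Js; case: eqP => // eJ; rewrite -eJ Js in Is.
by rewrite addrA [_ + (e - _)]addrC subrK.
Qed.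

(** A triangular system: each [v_I] is untouched by the steps before its own,
    and is killed by it. *)
Lemma reduce_zvec s I :
  pairwise (fun J J' => coef (zvec_itv W J') J.1 == 0) s ->
  (forall J, J \in s -> coef (zvec_itv W J) J.1 = 1) ->
  I \in s -> reduce s (zvec_itv W I) = 0.
Proof.
elim: s => // J s IH; rewrite pairwise_cons => /andP [/allP h hs] h1.
rewrite reduce_cons inE => /orP [/eqP ->|Is].
  by rewrite h1 ?mem_head // subrr raddf0.
rewrite (eqP (h _ Is)) mulr0z subr0; apply: IH => // K Ks.
by apply: h1; rewrite inE Ks orbT.
Qed.

Definition deg e : int := \sum_(u : W) e u.

Lemma degB : {morph deg : e e' / e - e'}.
Proof.
by move=> e e'; rewrite /deg -sumrB; apply: eq_bigr => u _; rewrite !ffunE.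
Qed.
HB.instance Definition _ :=
  GRing.isZmodMorphism.Build {ffun W -> int} int deg degB.

Lemma deg_zvec a : a \in W -> deg (zvec W a) = 1.
Proof.
move=> aW; rewrite /deg (bigD1 (Sub a aW)) //= ffunE /= eqxx big1 ?addr0 //.
by move=> u; rewrite ffunE -val_eqE /= => /negbTE ->.
Qed.

Lemma deg_zvec_itv I : (verts I `<=` W)%fset -> deg (zvec_itv W I) = 0.
Proof.
move=> /fsubsetP sI; rewrite /zvec_itv !raddfB raddfD /= !deg_zvec //;
  by apply: sI; rewrite !inE eqxx ?orbT.
Qed.

Lemma deg_reduce s e : (forall I, I \in s -> (verts I `<=` W)%fset) ->
  deg (reduce s e) = deg e.
Proof.
elim: s e => // I s IH e sW; rewrite reduce_cons IH; last first.
  by move=> J Js; apply: sW; rewrite inE Js orbT.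
by rewrite raddfB raddfMz /= deg_zvec_itv ?sW ?mem_head //= mul0rz subr0.
Qed.

Lemma coef_zvec_itv I a : a \in W -> coef (zvec_itv W I) a =
  (a == cornera I)%:Z + (a == cornerb I)%:Z - (a == cornerc I)%:Z - (a == cornerd I)%:Z.
Proof.
by move=> aW; rewrite -[a]/(val (Sub a aW : W)) coef_val !ffunE.
Qed.

(** Ordered by the sum of the coordinates, the lower left corner of an interval
    comes first among its corners. *)
Lemma reduce_zvec_sorted (D : {fset zitv}) I :
  (forall J, J \in D -> proper J) -> (forall J, J \in D -> J.1 \in W) ->
  (forall J J', J \in D -> J' \in D -> J.1 = J'.1 -> J = J') -> I \in D ->
  reduce (sort (fun J J' => J.1.1 + J.1.2 <= J'.1.1 + J'.1.2) D) (zvec_itv W I) = 0.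
Proof.
move=> pD DW inj ID; set r := (fun J J' => _).
have rT : total r by move=> ? ?; apply: le_total.
have rt : transitive r by move=> ? ? ?; apply: le_trans.
apply: reduce_zvec; rewrite ?mem_sort //; last first.
  move=> J; rewrite mem_sort => JD; rewrite coef_zvec_itv ?DW //.
  rewrite /cornera /cornerb /cornerc /cornerd eqxx.
  have := pD _ JD; rewrite /proper.
  by case: (J) => [[? ?] [? ?]] /=; rewrite !xpair_eqE; lia.
have : pairwise (fun J J' => r J J' && (J != J')) (sort r D).
  rewrite pairwise_relI -sorted_pairwise // sort_sorted //=.
  by rewrite -uniq_pairwise sort_uniq fset_uniq.
apply: (@sub_in_pairwise _ (mem (sort r D))) => [J J'|]; last exact/allP.
rewrite !mem_sort => JD J'D /andP [le_JJ' ne].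
have ne1 : J.1 != J'.1 by apply: contra_neq ne; apply: inj.
rewrite coef_zvec_itv ?DW //; move: le_JJ' ne1 (pD _ J'D).
rewrite /r /cornera /cornerb /cornerc /cornerd /proper.
by case: J J' {ne JD J'D} => [[? ?] [? ?]] [[? ?] [? ?]] /=; rewrite !xpair_eqE; lia.
Qed.

End Exponents.

(** * Monomials with integer exponent vectors *)

Section Monomials.
Variables (K : fieldType) (W : {fset point}).
Implicit Types (e u w : {ffun W -> int}) (I : zitv).

Lemma var_val (t : W) : var K W (val t) = 'X_(enum_rank t).
Proof. by rewrite /var valK. Qed.

Definition nonneg u : Prop := forall t, 0 <= u t.

Lemma nonnegD u w : nonneg u -> nonneg w -> nonneg (u + w).
Proof. by move=> hu hw t; rewrite ffunE addr_ge0. Qed.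

Lemma nonneg_zvec a : nonneg (zvec W a).
Proof. by move=> t; rewrite ffunE. Qed.

Lemma monomialD u w : nonneg u -> nonneg w ->
  monomial K (u + w) = monomial K u * monomial K w.
Proof.
move=> hu hw; rewrite /monomial -big_split; apply: eq_bigr => t _ /=.
rewrite -exprD ffunE; congr (_ ^+ _); move: (hu t) (hw t); move: (u t) (w t); clear; lia.
Qed.

Lemma monomial_zvec a : a \in W -> monomial K (zvec W a) = var K W a.
Proof.
move=> aW; rewrite /monomial (bigD1 (Sub a aW)) //= ffunE /= eqxx expr1.
by rewrite big1 ?mulr1 // => t; rewrite ffunE -val_eqE /= => /negbTE ->.
Qed.

(** Every binomial is a monomial multiple of the one attached to the difference
    of its exponents. *)
Lemma binomial_parts e u w : nonneg u -> nonneg w -> u - w = e ->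
  nonneg (u - pos_part e) /\
  monomial K u - monomial K w = monomial K (u - pos_part e) *
    (monomial K (pos_part e) - monomial K (neg_part e)).
Proof.
move=> hu hw <-; set e' := u - w.
have hr : nonneg (u - pos_part e').
  by move=> t; rewrite /e' !ffunE; move: (hu t) (hw t); move: (u t) (w t); clear; lia.
have hp : nonneg (pos_part e') by move=> t; rewrite !ffunE; move: (u t) (w t); clear; lia.
have hn : nonneg (neg_part e') by move=> t; rewrite !ffunE; move: (u t) (w t); clear; lia.
split=> //; rewrite mulrBr -!monomialD // subrK; congr (_ - monomial K _).
by rewrite /neg_part addrA subrK /e' opprB addrC subrK.
Qed.

Definition zexp (m : 'X_{1..#|{: W}|}) : {ffun W -> int} :=
  [ffun t => (m (enum_rank t))%:Z].

Lemma zexp_nonneg m : nonneg (zexp m).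
Proof. by move=> t; rewrite ffunE. Qed.

Lemma zexp_inj : injective zexp.
Proof.
move=> m m' /ffunP h; apply/mnmP => i; have := h (enum_val i).
by rewrite !ffunE enum_valK => -[].
Qed.

Lemma zexpD m m' : zexp (m + m') = zexp m + zexp m'.
Proof. by apply/ffunP => t; rewrite !ffunE mnmDE PoszD. Qed.

Lemma monomial_zexp m : monomial K (zexp m) = 'X_[m].
Proof.
rewrite mpolyXE_id (reindex (@enum_rank W)); last first.
  by exists enum_val => ? _; rewrite ?enum_rankK ?enum_valK.
by apply: eq_bigr => t _; rewrite ffunE var_val.
Qed.

Lemma zexpE m : zexp m = \sum_i zvec W (val (enum_val i)) *+ m i.
Proof.
apply/ffunP => t; rewrite sum_ffunE (bigD1 (enum_rank t)) //= big1 ?addr0.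
  by rewrite ffunMnE !ffunE enum_rankK eqxx natz.
move=> i ne; rewrite ffunMnE ffunE val_eqE.
case: eqP => [e|_]; last by rewrite mul0rn.
by rewrite e enum_valK eqxx in ne.
Qed.

End Monomials.

Section Extension.
Variables (K : fieldType) (V W : {fset point}).
Hypothesis VW : (V `<=` W)%fset.

Definition extend (e : {ffun V -> int}) : {ffun W -> int} :=
  [ffun t => coef e (val t)].

Lemma extendB : {morph extend : e e' / e - e'}.
Proof. by move=> e e'; apply/ffunP => t; rewrite !ffunE coefB. Qed.
HB.instance Definition _ :=
  GRing.isZmodMorphism.Build {ffun V -> int} {ffun W -> int} extend extendB.

Lemma extend_zvec a : a \in V -> extend (zvec V a) = zvec W a.
Proof.
move=> aV; apply/ffunP => t; rewrite !ffunE /coef; case: insubP => [s _ <-|].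
  by rewrite ffunE.
by move=> tV; case: eqP => // e; rewrite e aV in tV.
Qed.

Lemma extend_zvec_itv I : (verts I `<=` V)%fset ->
  extend (zvec_itv V I) = zvec_itv W I.
Proof.
move=> /fsubsetP sI; rewrite /zvec_itv !raddfB raddfD /= !extend_zvec //;
  by apply: sI; rewrite !inE eqxx ?orbT.
Qed.

Lemma extend_pos e : extend (pos_part e) = pos_part (extend e).
Proof.
apply/ffunP => t; rewrite !ffunE /coef; case: insubP => [s _ _|_].
  by rewrite ffunE.
by rewrite maxxx.
Qed.

Lemma extend_neg e : extend (neg_part e) = neg_part (extend e).
Proof. by rewrite /neg_part raddfB /= extend_pos. Qed.

Lemma var_incl_monomial e :
  @var_incl K V W (monomial K e) = monomial K (extend e).
Proof.
rewrite /var_incl /monomial rmorph_prod /=.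
pose G a := var K W a ^+ absz (coef e a).
transitivity (\prod_(t : V) G (val t)).
  apply: eq_bigr => t _; rewrite rmorphXn /= var_val comp_mpolyXU.
  by rewrite -tnth_nth tnth_mktuple enum_rankK /G coef_val.
transitivity (\prod_(t : W) G (val t)); last first.
  by apply: eq_bigr => t _; rewrite /G ffunE.
rewrite -(big_seq_fsetE _ _ xpredT G) -(big_seq_fsetE _ _ xpredT G) /=.
apply: big_fset_incl => // a aW aV.
by rewrite /G /coef insubN.
Qed.

End Extension.

(** * The toric parametrisation of a component *)

(** Linear independence of the monomials, in the form in which it is used: a linear
    relation between monomials persists when they are replaced by arbitrary
    vectors. *)
Lemma monomials_free (K : fieldType) (n : nat) (V : lmodType K) (I : eqType)
    (s : seq I) (P : pred I) (a : I -> K) (k : I -> 'X_{1..n})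
    (c : 'X_{1..n} -> V) :
  \sum_(i <- s | P i) a i *: 'X_[k i] = 0 :> {mpoly K[n]} ->
  \sum_(i <- s | P i) a i *: c (k i) = 0.
Proof.
move=> h; pose ks := undup [seq k i | i <- s].
have -> : \sum_(i <- s | P i) a i *: c (k i) =
    \sum_(l <- ks) (\sum_(i <- s | P i) a i * (k i == l)%:R) *: c l.
  under [RHS]eq_bigr do rewrite scaler_suml.
  rewrite exchange_big /= big_seq_cond [RHS]big_seq_cond.
  apply: eq_bigr => i /andP [si _].
  rewrite (bigD1_seq (k i)) ?undup_uniq ?mem_undup ?map_f //= eqxx mulr1.
  by rewrite big1 ?addr0 // => l; rewrite eq_sym => /negbTE ->; rewrite mulr0 scale0r.
rewrite big1 // => l _.
have := congr1 (mcoeff l) h; rewrite raddf_sum mcoeff0 /=.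
under eq_bigr do rewrite mcoeffZ mcoeffX.
by move=> ->; rewrite scale0r.
Qed.

Section Residual.
Variables (R : realType) (K : fieldType) (C : {fset zitv}) (X : {fset point}).
Hypotheses (hC : polyocollection C) (admX : admissible R C X).

Let D := residual R C X.
Let W := vset C.
Let n := #|{: W}|.

Let gD : generates_avoiding R C X D := residualP R X hC.
Let pD I : I \in D -> proper I. Proof. by case: gD => h _ _; apply: h. Qed.

Lemma residual_avoiding I : I \in D -> inner_avoiding R C X I.
Proof.
case: gD => _ _ <- ID; apply: mem_inner => //; exact/proper_interval/pD.
Qed.

Lemma residual_verts I : I \in D -> (verts I `<=` W)%fset.
Proof. by move=> /residual_avoiding [/inner_verts]. Qed.

Lemma vset_residual : (vset D `<=` W)%fset.
Proof. by apply/bigfcupsP => I ID _; apply: residual_verts. Qed.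

Lemma residual_corner I : I \in D -> I.1 \in W.
Proof. by move=> /residual_verts /fsubsetP; apply; rewrite vertsP eqxx. Qed.

Lemma verts_vset I : I \in D -> (verts I `<=` vset D)%fset.
Proof. by move=> ID; apply: bigfcup_sup. Qed.

Lemma lattice_extend (c : zitv -> int) :
  extend W (\sum_(I <- D) zvec_itv (vset D) I *~ c I) = \sum_(I <- D) zvec_itv W I *~ c I.
Proof.
rewrite raddf_sum big_seq [RHS]big_seq; apply: eq_bigr => I ID.
by rewrite raddfMz /= extend_zvec_itv // verts_vset.
Qed.

Let J := J_ideal R K C X.

Lemma J_ideal_ideal : is_ideal J.
Proof. by apply: ideal_add_ideal; apply: ideal_span_ideal. Qed.

Lemma J_ideal_var a : a \in X -> J (var K W a).
Proof.
move=> aX; exists (var K W a), 0; split; rewrite ?addr0 //.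
  by apply: mem_ideal_span; exists a.
by have [] := ideal_span_ideal (@var_incl K (vset D) W @` lattice_ideal K D)%classic.
Qed.

Lemma J_ideal_binomial (e : {ffun W -> int}) : zspan D e ->
  J (monomial K (pos_part e) - monomial K (neg_part e)).
Proof.
move=> [c ->]; set e' : {ffun vset D -> int} := \sum_(I <- D) zvec_itv (vset D) I *~ c I.
exists 0, (@var_incl K (vset D) W (monomial K (pos_part e') - monomial K (neg_part e'))).
split; last 1 first.
- rewrite add0r /var_incl raddfB /= -!/(var_incl _ _) !var_incl_monomial ?vset_residual //.
  by rewrite extend_pos extend_neg lattice_extend.
- by have [] := ideal_span_ideal [set var K (vset C) a | a in [set` X]]%classic.
apply: mem_ideal_span; eexists; last reflexivity.
by apply: mem_ideal_span; exists e' => //; exists c.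
Qed.

Let s : seq zitv :=
  sort (fun I I' : zitv => I.1.1 + I.1.2 <= I'.1.1 + I'.1.2) D.
Let red : {ffun W -> int} -> {ffun W -> int} := reduce s.

(** Members of the residual collection are killed by triangularity, the other
    inner intervals because [v_I] is additive on tilings. *)
Lemma red_inner I : inner_avoiding R C X I -> red (zvec_itv W I) = 0.
Proof.
have [_ _ <-] := gD => /(inner_tiles R _ pD) [pI [t tD ht]].
rewrite (zvec_itv_tiles W _ pI ht) => [|T /(fsubsetP tD) /pD //].
rewrite /red raddf_sum big_seq big1 // => T /(fsubsetP tD) TD.
apply: reduce_zvec_sorted => //; first exact: residual_corner.
by move=> I1 I2; apply: (irredundant_corner_inj hC admX gD).
Qed.

Lemma red_ker e : red e = 0 -> zspan D e.
Proof.
move=> h; have [|c hc] := @reduce_span W s e; first by rewrite sort_uniq fset_uniq.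
have sD : perm_eq s D by rewrite perm_sort.
by exists c; rewrite -(perm_big _ sD) -hc -/(red e) h subr0.
Qed.

Lemma deg_red e : deg (red e) = deg e.
Proof. by apply: deg_reduce => I; rewrite mem_sort; apply: residual_verts. Qed.

(** An upper bound for the negative exponents produced by [red]. *)
Let N : nat := \sum_(t : W) \sum_(t' : W) absz (red (zvec W (val t)) t').

(** Shifting all exponents by [N] makes them nonnegative, so that a polynomial ring
    can replace a Laurent polynomial ring. The shift does not enlarge the kernel
    because [red] preserves the degree. *)
Definition weight (t : W) : 'X_{1..n} :=
  [multinom absz (red (zvec W (val t)) (enum_val i) + N%:Z)%R | i < n].

Lemma zexp_weight t : zexp (weight t) = red (zvec W (val t)) + [ffun => N%:Z].
Proof.
apply/ffunP => t'; rewrite !ffunE mnmE enum_rankK gez0_abs //.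
have : (absz (red (zvec W (val t)) t') <= N)%N.
  rewrite /N (bigD1 t) //= (bigD1 t') //= -addnA; exact: leq_addr.
by move: (red _ _) N; clear; lia.
Qed.

Definition mono_image (m : 'X_{1..n}) : 'X_{1..n} :=
  (\sum_i weight (enum_val i) *+ m i)%MM.

Lemma zexp_mono_image m :
  zexp (mono_image m) = red (zexp m) + [ffun => N%:Z * deg (zexp m)].
Proof.
have zexp0 : zexp (0%MM : 'X_{1..n}) = 0.
  by apply/ffunP => t; rewrite !ffunE mnm0E.
have zexpMn (m' : 'X_{1..n}) k : zexp (m' *+ k)%MM = zexp m' *+ k.
  elim: k => [|k IH]; first by rewrite mulm0n mulr0n.
  by rewrite mulmS zexpD IH mulrS.
rewrite /mono_image (big_morph _ (@zexpD W) zexp0).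
rewrite {1}zexpE /red raddf_sum -/red.
have -> : deg (zexp m) = \sum_i (m i)%:Z.
  rewrite /deg (reindex (@enum_val W W)) /=; last first.
    by exists enum_rank => ? _; rewrite ?enum_rankK ?enum_valK.
  by apply: eq_bigr => i _; rewrite ffunE enum_valK.
have -> : [ffun => N%:Z * \sum_i (m i)%:Z] =
    \sum_i [ffun => N%:Z] *+ m i :> {ffun W -> int}.
  apply/ffunP => t; rewrite sum_ffunE ffunE mulr_sumr; apply: eq_bigr => i _.
  by rewrite ffunMnE ffunE -mulr_natr natz.
rewrite -big_split; apply: eq_bigr => i _ /=.
by rewrite zexpMn zexp_weight mulrnDl raddfMn.
Qed.

(** Comparing degrees recovers the degree of [m] from [mono_image m], hence also
    its reduction; two monomials with the same reduction differ by an element of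
    the lattice. *)
Lemma mono_image_ker m m' : mono_image m = mono_image m' ->
  J ('X_[m] - 'X_[m']).
Proof.
move=> /(congr1 (@zexp W)); rewrite !zexp_mono_image => h.
have degc (x : int) : deg ([ffun => x] : {ffun W -> int}) = x *+ #|{: W}|.
  by rewrite /deg; under eq_bigr do rewrite ffunE; rewrite sumr_const.
(* The image of [m] has degree [(1 + N * #|W|) * deg m]. *)
have ed : deg (zexp m) = deg (zexp m').
  have := congr1 (@deg W) h; rewrite !raddfD /= !deg_red !degc.
  move: (deg _) (deg _) #|{: W}| N => x y k l; clear.
  rewrite -[_ * x *+ k]mulr_natr -[_ * y *+ k]mulr_natr !natz => e.
  have nz : 1 + l%:Z * k%:Z != 0 by rewrite -PoszM -(PoszD 1).
  apply: (mulIf nz); rewrite /=; transitivity (x + l%:Z * x * k%:Z); last by ring.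
  by rewrite -e; ring.
have e0 : red (zexp m - zexp m') = 0.
  by rewrite /red raddfB /= -/red; apply/eqP; rewrite subr_eq0; apply/eqP;
    move: h; rewrite ed => /addIr.
have [_] := binomial_parts K (zexp_nonneg m) (zexp_nonneg m') erefl.
rewrite !monomial_zexp => ->; have [_ _ JM] := J_ideal_ideal.
by apply/JM/J_ideal_binomial/red_ker.
Qed.

(** The coordinates of a general point of the component attached to [X]. *)
Definition general_point : n.-tuple {mpoly K[n]} :=
  [tuple if val (enum_val i : W) \in X then 0 else 'X_[weight (enum_val i)] | i < n].

Local Notation toric := (comp_mpoly general_point).

Lemma toric_var (t : W) :
  toric (var K W (val t)) = if val t \in X then 0 else 'X_[weight t].
Proof. by rewrite var_val comp_mpolyXU -tnth_nth tnth_mktuple enum_rankK. Qed.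

Definition meets (m : 'X_{1..n}) : bool :=
  [exists i, (val (enum_val i : W) \in X) && (m i != 0)%N].

Lemma toric_monomial (m : 'X_{1..n}) :
  toric 'X_[m] = if meets m then 0 else 'X_[mono_image m].
Proof.
rewrite comp_mpolyX; case: ifPn => [/existsP [i /andP [iX mi]]|nX].
  by rewrite (bigD1 i) //= tnth_mktuple iX expr0n (negbTE mi) mul0r.
rewrite /mono_image (big_morph _ (@mpolyXD n K) (@mpolyX0 n K)).
apply: eq_bigr => i _; rewrite -mpolyXn tnth_mktuple; case: ifPn => // iX.
have -> : m i = 0%N by apply/eqP; move/existsPn: nX => /(_ i); rewrite iX negbK.
by rewrite !expr0.
Qed.

Lemma J_ideal_meets m : meets m -> J 'X_[m].
Proof.
move=> /existsP [i /andP [iX mi]]; rewrite mpolyXE_id (bigD1 i) //=.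
have JI := J_ideal_ideal; apply: idealMr => //.
have := J_ideal_var iX; rewrite var_val enum_valK.
by case: (m i) mi => // k _; rewrite exprS; apply: idealMr.
Qed.

(** Modulo [J], a monomial is 0 or depends only on its image, so [f] is congruent
    to a combination of representatives of the images, whose coefficients are
    those of [toric f]. *)
Lemma toric_ker f : toric f = 0 -> J f.
Proof.
move=> f0; have JI := J_ideal_ideal; have [J0 JD JM] := JI.
have JZ a p : J p -> J (a *: p) by rewrite -mul_mpolyC; apply: JM.
have /choice [c hc] : forall k : 'X_{1..n}, exists x : polyring K W,
    forall m, mono_image m = k -> J ('X_[m] - x).
  move=> k; have [[m0 <-]|no] := pselect (exists m0, mono_image m0 = k).
    by exists 'X_[m0] => m /mono_image_ker.
  by exists 0 => m e; case: no; exists m.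
have h0 : \sum_(m <- msupp f | ~~ meets m) f@_m *: 'X_[mono_image m] = 0 :> {mpoly K[n]}.
  move: f0; rewrite {1}[f]mpolyE raddf_sum /= (bigID meets) /= big1 ?add0r => [|m hm].
    move=> f0'; rewrite -[RHS]f0'; apply: eq_bigr => m hm.
    by rewrite linearZ /= toric_monomial (negbTE hm).
  by rewrite linearZ /= toric_monomial hm scaler0.
have h1 := monomials_free c h0.
have good : \sum_(m <- msupp f | ~~ meets m) f@_m *: 'X_[m] =
    \sum_(m <- msupp f | ~~ meets m) f@_m *: ('X_[m] - c (mono_image m)).
  under [RHS]eq_bigr do rewrite scalerBr.
  by rewrite sumrB h1 subr0.
rewrite [f]mpolyE (bigID meets) /= good; apply: JD; apply: ideal_sum => // m hm.
  exact/JZ/J_ideal_meets.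
exact/JZ/hc.
Qed.

(** If [X] contains the ends of an edge of [I], both terms of the minor vanish;
    otherwise [I] is tiled by members of the residual collection, and the two terms
    have the same reduced exponent. *)
Lemma toric_minor I : inner R C I -> toric (inner_minor K C I) = 0.
Proof.
move=> hI; have vW a : a \in verts I -> a \in W.
  exact: (fsubsetP (inner_verts hI)).
have tv a (aI : a \in verts I) :
    toric (var K W a) = if a \in X then 0 else 'X_[weight (Sub a (vW _ aI))].
  by rewrite -(toric_var (Sub a (vW _ aI))).
have [Ia Ib Ic Id] : [/\ cornera I \in verts I, cornerb I \in verts I,
    cornerc I \in verts I & cornerd I \in verts I].
  by split; rewrite !inE eqxx ?orbT.
rewrite /inner_minor rmorphB !rmorphM /= !(tv _ Ia, tv _ Ib, tv _ Ic, tv _ Id).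
case: (admX.2 _ hI) => [dis|[F FI /fsubsetP FX]].
  have av : inner_avoiding R C X I by split=> //; rewrite fsetIC.
  rewrite !(negbTE (avoiding_notin av _)) // -!mpolyXD.
  apply/eqP; rewrite subr_eq0; apply/eqP; congr 'X_[_]; apply: zexp_inj.
  have zw a (aI : a \in verts I) :
    zexp (weight (Sub a (vW _ aI))) = red (zvec W a) + [ffun => N%:Z].
    by rewrite zexp_weight.
  rewrite !zexpD !zw [LHS]addrACA [RHS]addrACA; congr (_ + _).
  apply/eqP; rewrite -subr_eq0 opprD addrA.
  by have := red_inner av; rewrite /zvec_itv /red !raddfB raddfD /= => ->.
have inX a : a \in boundary F -> a \in X by move=> /FX /fsetIP [].
have := inX F.1; have := inX F.2; rewrite !inE !eqxx orbT => /(_ isT) h2 /(_ isT) h1.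
by move: FI h1 h2; rewrite !inE => /or4P [] /eqP -> /= -> ->;
  rewrite ?mul0r ?mulr0 subrr.
Qed.

Lemma radical_sub_J_ideal f : radical (polyo_ideal R K C) f -> J f.
Proof.
move=> [k k0 hk]; apply: toric_ker; apply/eqP.
have : toric (f ^+ k) = 0.
  move: hk; apply: (ideal_span_min (J := [set p | toric p = 0]%classic)).
    split=> [|p q /= hp hq|h p /= hp]; first exact: raddf0.
      by rewrite raddfD /= hp hq addr0.
    by rewrite rmorphM /= hp mulr0.
  by move=> _ [I hI <-]; apply: toric_minor.
by rewrite rmorphXn /= => /eqP; rewrite expf_eq0 k0.
Qed.

End Residual.

(** * The saturation of the ideal of minors *)

Section Converse.
Variables (R : realType) (K : fieldType) (C : {fset zitv}) (P : pred point).
Hypothesis hC : polyocollection C.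
Let W := vset C.
Let X : {fset point} := [fset a in W | P a]%fset.
Let U : polyring K W := \prod_(a <- W | ~~ P a) var K W a.
Let Q : set (polyring K W) := ideal_span
  (inner_minor K C @` inner R C `|`
    [set var K W a | a in [set a | (a \in W) && P a]])%classic.
Let S := saturation Q U.

Let QI : is_ideal Q := ideal_span_ideal _.
Let SI : is_ideal S := saturation_ideal U QI.

Let mem_X a : (a \in X) = (a \in W) && P a.
Proof. by rewrite !inE. Qed.

Lemma Q_var a : a \in X -> Q (var K W a).
Proof. by rewrite mem_X => aX; apply: mem_ideal_span; right; exists a. Qed.

Lemma Q_minor I : inner R C I -> Q (inner_minor K C I).
Proof. by move=> hI; apply: mem_ideal_span; left; exists I. Qed.

Lemma var_dvd_U a : a \in W -> a \notin X -> exists r, U = r * var K W a.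
Proof.
rewrite mem_X => aW; rewrite aW /= => aP.
exists (\prod_(b <- W | b != a) if ~~ P b then var K W b else 1).
by rewrite mulrC /U big_mkcond (bigD1_seq a) ?fset_uniq //= aP.
Qed.

Lemma S_cancel_monomial (u : {ffun W -> int}) g :
  (forall t : W, val t \in X -> u t = 0) -> S (monomial K u * g) -> S g.
Proof.
move=> u0; rewrite /monomial.
pose can p := forall g, S (p * g) -> S g.
have can1 : can 1 by move=> h; rewrite mul1r.
have canM p q : can p -> can q -> can (p * q).
  by move=> hp hq h; rewrite -mulrA => /hp /hq.
suff : can (\prod_(t : W) var K W (val t) ^+ absz (u t)) by apply.
apply: big_ind => // t _; have [tX|tX] := boolP (val t \in X).
  by rewrite u0.
have hv : can (var K W (val t)).
  by move=> h; apply: saturation_cancel => //; apply: var_dvd_U => //; exact: valP.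
by elim: absz => // k IH; rewrite exprS; apply: canM.
Qed.

(** Asking for some binomial with exponent difference [e], rather than for all of
    them, makes this set of vectors visibly a subgroup; the cancellation of
    monomials prime to [X] recovers the others ([binomial_diff_S]). *)
Definition binomial_diff (e : {ffun W -> int}) : Prop := exists u w,
  [/\ nonneg u, nonneg w, u - w = e,
      forall t : W, val t \in X -> u t = 0 /\ w t = 0
    & S (monomial K u - monomial K w)].

Lemma binomial_diff0 : binomial_diff 0.
Proof.
have n0 : nonneg (0 : {ffun W -> int}) by move=> t; rewrite ffunE.
exists 0, 0; split; rewrite ?subr0 //; first by move=> t _; rewrite ffunE.
by rewrite subrr; case: SI.
Qed.

Lemma binomial_diffD e e' : binomial_diff e -> binomial_diff e' ->
  binomial_diff (e + e').
Proof.
move=> [u [w [u0 w0 <- uX h]]] [u' [w' [u'0 w'0 <- u'X h']]].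
exists (u + u'), (w + w'); split; try exact: nonnegD.
- by rewrite opprD addrACA.
- move=> t tX; have [h1 h2] := uX t tX; have [h3 h4] := u'X t tX.
  by rewrite !ffunE h1 h2 h3 h4.
rewrite !monomialD //.
have -> : monomial K u * monomial K u' - monomial K w * monomial K w' =
    monomial K u * (monomial K u' - monomial K w') +
    monomial K w' * (monomial K u - monomial K w) by ring.
by have [_ SD SM] := SI; apply: SD; apply: SM.
Qed.

Lemma binomial_diffN e : binomial_diff e -> binomial_diff (- e).
Proof.
move=> [u [w [u0 w0 e1 uX h]]]; exists w, u; split=> //.
- by rewrite -e1 opprB.
- by move=> t /uX [].
by rewrite -opprB -mulN1r; have [_ _ SM] := SI; apply: SM.
Qed.

Lemma binomial_diff_itv I : inner_avoiding R C X I -> binomial_diff (zvec_itv W I).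
Proof.
move=> hI; have vW a : a \in verts I -> a \in W.
  exact: (fsubsetP (inner_verts hI.1)).
have vX a : a \in verts I -> forall t : W, val t \in X -> zvec W a t = 0.
  move=> aI t tX; rewrite ffunE; case: eqP => // e.
  by have := avoiding_notin hI aI; rewrite -e tX.
have [Ia Ib Ic Id] : [/\ cornera I \in verts I, cornerb I \in verts I,
    cornerc I \in verts I & cornerd I \in verts I].
  by split; rewrite !inE eqxx ?orbT.
exists (zvec W (cornera I) + zvec W (cornerb I)).
exists (zvec W (cornerc I) + zvec W (cornerd I)); split.
- by apply: nonnegD; apply: nonneg_zvec.
- by apply: nonnegD; apply: nonneg_zvec.
- by rewrite opprD addrA.
- by move=> t tX; split; rewrite ffunE !vX.
rewrite !monomialD ?monomial_zvec ?vW //; try exact: nonneg_zvec.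
exact/sub_saturation/Q_minor/hI.1.
Qed.

Lemma binomial_diff_S e : binomial_diff e ->
  S (monomial K (pos_part e) - monomial K (neg_part e)).
Proof.
move=> [u [w [u0 w0 e1 uX h]]].
have [r0 e2] := binomial_parts K u0 w0 e1; rewrite e2 in h.
apply: S_cancel_monomial h => t tX; have [h1 h2] := uX t tX.
by rewrite -e1 !ffunE h1 h2.
Qed.

Lemma J_ideal_saturation f : J_ideal R K C X f -> S f.
Proof.
have [S0 SD SM] := SI; move=> [g [h [hg hh ->]]]; apply: SD.
  apply: ideal_span_min hg => // _ [a aX <-].
  exact/sub_saturation/Q_var.
apply: ideal_span_min hh => // _ [p hp <-].
pose D := residual R C X.
apply: (ideal_span_min (J := [set p | S (@var_incl K (vset D) W p)]%classic)) hp.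
  exact: (@ideal_preim _ _
    (comp_mpoly [tuple var K W (val (enum_val i)) | i < #|{: vset D}|]) _ SI).
move=> _ [e [c ec] <-] /=.
have DW := vset_residual R X hC.
rewrite /var_incl raddfB /= -!/(var_incl _ _) !var_incl_monomial ?DW //.
rewrite extend_pos extend_neg; apply: binomial_diff_S.
rewrite ec lattice_extend // big_seq.
apply: big_ind => [|e1 e2|I ID]; first exact: binomial_diff0.
  exact: binomial_diffD.
have hI := binomial_diff_itv (residual_avoiding hC ID).
have nat_mul k : binomial_diff (zvec_itv W I *+ k).
  elim: k => [|k IH]; first exact: binomial_diff0.
  by rewrite mulrS; apply: binomial_diffD.
by case: (c I) => k; [apply: nat_mul | apply/binomial_diffN/nat_mul].
Qed.

(** Some inner interval has a corner in [X] whose two neighbours are both outside;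
    modulo [X] its minor is, up to sign, the product of these neighbours, and
    [U * U] is a multiple of it. *)
Lemma not_admissible_nilpotent : ~ admissible R C X -> Q (U * U).
Proof.
move=> nadm; have QB := idealB QI; have [Q0 QD QM] := QI.
have [I hI [a /andP [aX aI] noF]] : exists2 I, inner R C I &
     exists2 a, (a \in X) && (a \in verts I) &
     forall F, F \in edges I -> ~~ ((F.1 \in X) && (F.2 \in X)).
  apply: contrapT => no; apply: nadm; split=> [|I hI].
    by apply/fsubsetP => a; rewrite mem_X => /andP [].
  have [e|/fset0Pn [a /fsetIP [aX aI]]] := eqVneq (X `&` verts I)%fset fset0.
    by left.
  right; apply: contrapT => noF; apply: no; exists I => //; exists a.
    by rewrite aX.
  move=> F FI; apply/negP => /andP [F1 F2]; apply: noF; exists F => //.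
  apply/fsubsetP => b; rewrite in_fsetI => /fset2P [] ->; rewrite ?F1 ?F2 /=.
    by move: FI; rewrite !inE => /or4P [] /eqP ->; rewrite /= eqxx ?orbT.
  by move: FI; rewrite !inE => /or4P [] /eqP ->; rewrite /= eqxx ?orbT.
have vW b : b \in verts I -> b \in W by exact: (fsubsetP (inner_verts hI)).
have UU p q : p \in verts I -> p \notin X -> q \in verts I -> q \notin X ->
    Q (var K W p * var K W q) -> Q (U * U).
  move=> pI pX qI qX pq; have [r er] := var_dvd_U (vW _ pI) pX.
  have [r' er'] := var_dvd_U (vW _ qI) qX.
  by rewrite {1}er er' mulrACA; apply: QM.
have {noF} off p q : (p, q) \in edges I -> (p \notin X) || (q \notin X).
  by move=> /noF; rewrite negb_and.
have [Ia Ib Ic Id] : [/\ cornera I \in verts I, cornerb I \in verts I,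
    cornerc I \in verts I & cornerd I \in verts I].
  by split; rewrite !inE eqxx ?orbT.
have eac : (cornera I, cornerc I) \in edges I by rewrite !inE eqxx.
have ead : (cornera I, cornerd I) \in edges I by rewrite !inE eqxx ?orbT.
have edb : (cornerd I, cornerb I) \in edges I by rewrite !inE eqxx ?orbT.
have ecb : (cornerc I, cornerb I) \in edges I by rewrite !inE eqxx ?orbT.
have minor := Q_minor hI; rewrite /inner_minor in minor.
have Qa := Q_var aX.
have diag : Q (var K W (cornera I) * var K W (cornerb I)) ->
    Q (var K W (cornerc I) * var K W (cornerd I)).
  by move=> h; have := QB _ _ h minor; rewrite opprB addrC subrK.
have anti : Q (var K W (cornerc I) * var K W (cornerd I)) ->
    Q (var K W (cornera I) * var K W (cornerb I)).
  by move=> h; have := QD _ _ minor h; rewrite subrK.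
move: aI (off _ _ eac) (off _ _ ead) (off _ _ edb) (off _ _ ecb); rewrite {1}vertsP.
rewrite -[I.1]/(cornera I) -[I.2]/(cornerb I) -[(I.1.1, _)]/(cornerc I).
rewrite -[(I.2.1, _)]/(cornerd I).
case/or4P => /eqP ea; rewrite -?ea aX ?orbF /=; rewrite ?ea => h1 h2 h3 h4.
- by apply: (UU (cornerc I) (cornerd I)) => //; apply: diag; rewrite -ea; apply: idealMr.
- by apply: (UU (cornerc I) (cornerd I)) => //; apply: diag; rewrite -ea; apply: QM.
- by apply: (UU (cornera I) (cornerb I)) => //; apply: anti; rewrite -ea; apply: idealMr.
- by apply: (UU (cornera I) (cornerb I)) => //; apply: anti; rewrite -ea; apply: QM.
Qed.

Lemma radical_of_J f :
  (forall Y, admissible R C Y -> J_ideal R K C Y f) -> radical Q (U * f).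
Proof.
move=> hf; have [admX|nadm] := pselect (admissible R C X).
  by apply: saturation_radical => //; apply/J_ideal_saturation/hf.
exists 2%N => //; rewrite exprMn -[U ^+ 2]/(U * U); apply: idealMr => //.
exact: not_admissible_nilpotent.
Qed.

End Converse.

(** * The radical *)

Theorem theorem3p12 (R : realType) (K : fieldType) (C : {fset zitv})
    (hC : polyocollection C) :
  radical (polyo_ideal R K C) =
  (\bigcap_(X in [set X | admissible R C X]) J_ideal R K C X)%classic.
Proof.
apply/seteqP; split=> [f hf X admX|f hf]; first exact: radical_sub_J_ideal hC admX f hf.
apply: (radical_cases (y := var K (vset C)) (s := vset C)); first exact: fset_uniq.
by move=> P; apply: radical_of_J.
Qed.
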